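(* Given an arbitrary nonempty subset $E$ of $\mathbb{R}^n$, a linear subspace $X\subset\mathbb{R}^n$, the orthogonal projection $P:=P_{X}:\mathbb{R}^n\to X$, and two functions $f:E \to \mathbb{R}$, $G: E \to \mathbb{R}^n$, the following is true. There exists a convex function $F:\mathbb{R}^n\to\mathbb{R}$ of class $C^{1,1}_{\mathrm{loc}}$ such that $F_{|_E}=f$, $(\nabla F)_{|_E} =G$, and $X_{F}=X$, if and only if the following conditions are satisfied. (i) $Y:=\mathrm{span}\left(\{G(y)-G(z) : y, z\in E\}\right)\subseteq X$. (ii) If $k:=\dim Y< d:= \dim X$, then there exist points $p_1, \ldots, p_{d-k} \in \mathbb{R}^n \setminus E$, numbers $\beta_1,\ldots, \beta_{d-k} \in \mathbb{R}$, and vectors $w_1, \ldots, w_{d-k} \in \mathbb{R}^n$ such that for every $y\in E^{*}:=E\cup\{p_1, \ldots, p_{d-k}\}$ there exists a (not necessarily convex) function $\varphi_{y}:X\to [0, \infty)$ of class $C^{1,1}_{\mathrm{loc}}$ such that, denoting $t_y:=f(y)$ and $\xi_y:=G(y)$ for $y\in E$; $t_y:=\beta_j$ and $\xi_y:=w_j$ for $y=p_j$, $j=1, \ldots, d-k$, we have that: $$\mathrm{span}\{\xi_y-\xi_z : y, z \in E^{*}\}=X;$$ $$\varphi_{y}(P(y))=0,\quad \nabla\varphi_{y}(P(y))=0 \quad\text{for every } y\in E^*;$$ $$\sup\left\{\frac{|\nabla\varphi_{y}(u)-\nabla\varphi_{y}(v)|}{|u-v|} \, : \, y\in E^{*}\cap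 P^{-1}(B_{X}(0, R)),\ u, v\in B_{X}(0, R),\ u\neq v \right\}<\infty$$ for every $R>0$; and $$t_z+\langle \xi_z, x-z\rangle \leq t_y +\langle \xi_y, x-y\rangle +\varphi_{y}(P(x))$$ for every $z, y \in E^{*}$ and every $x\in \mathbb{R}^n$. (iii) If $k=d$, then the preceding condition holds with $E$ in place of $E^{*}$ (no need to add new data). Moreover, whenever these conditions are satisfied, for every number $a>0$ the formula $$F=\mathrm{conv}\left(x\mapsto \inf_{y\in E^{*}}\left\{t_y+ \langle\xi_y, x-y\rangle+\varphi_{y}(P(x))+a|P(x-y)|^2\right\}\right)$$ (with $E^*=E$ if $k=d$) defines a $C^{1,1}_{\mathrm{loc}}$ convex extension of the jet $(f, G)$ to $\mathbb{R}^n$ (that is, $F=f$, $\nabla F=G$ on $E$) which satisfies $X_F=X$.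
   Context: $|\cdot|$, $\langle\cdot,\cdot\rangle$ are the Euclidean norm and inner product. $B_X(0,r)$ is the closed ball of center $0$ and radius $r$ in $X$. $C^{1,1}_{\mathrm{loc}}$ is the class of differentiable functions whose gradient is locally Lipschitz (Lipschitz on every ball). A supremum over the empty set of nonnegative quantities is $0$. $\mathrm{conv}(g)(x)=\sup\{\varphi(x) : \varphi \text{ convex}, \varphi\leq g\}$ is the convex envelope of $g:\mathbb{R}^n\to\mathbb{R}$. For a convex function $F:\mathbb{R}^n\to\mathbb{R}$, $X_F:=\mathrm{span}\{u-w : u\in\partial F(x), w\in\partial F(y), x,y\in\mathbb{R}^n\}$, where $\partial F$ is the subdifferential; for differentiable $F$, $X_F=\mathrm{span}\{\nabla F(x)-\nabla F(y): x,y\in\mathbb{R}^n\}$. *)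

(* Defs.v *)
From HB Require Import structures.
From mathcomp Require Import all_boot all_order all_algebra.
From mathcomp Require Import all_classical all_reals all_analysis.
From mathcomp Require Import ring.

Set Implicit Arguments.
Unset Strict Implicit.
Unset Printing Implicit Defensive.

Import Order.TTheory GRing.Theory Num.Theory.
Import numFieldNormedType.Exports.

Local Open Scope classical_set_scope.
Local Open Scope convex_scope.
Local Open Scope ring_scope.

Section Span.
Context {K : fieldType} {V : vectType K}.

Definition linear_combinations (A : set V) : set V :=
  [set x | exists2 s : seq V, (forall v, v \in s -> A v) & x \in span s].

(* The default value is never used, see [mem_setspan]. *)
Definition setspan (A : set V) : {vspace V} :=
  xget 0%VS [set U : {vspace V} | [set x | x \in U] = linear_combinations A].

Lemma mem_setspan (A : set V) (x : V) :
  x \in setspan A <-> linear_combinations A x.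
Proof.
suff [U UA] : exists U : {vspace V}, [set x | x \in U] = linear_combinations A.
  have := @xgetI _ 0%VS [set U : {vspace V} |
    [set x | x \in U] = linear_combinations A] U UA.
  by rewrite -/(setspan A) /= => /(congr1 (@^~ x)) /= <-.
pose D k := `[< exists2 s : seq V,
  (forall v, v \in s -> A v) & \dim (span s) = k >].
have D0 : exists k, D k.
  by exists (\dim (span ([::] : seq V))); apply/asboolP; exists [::].
have Dle k : D k -> (k <= \dim {:V})%N.
  by move=> /asboolP[s _ <-]; rewrite dimvS// subvf.
have [k /asboolP[s sA sk] kmax] := ex_maxnP D0 Dle.
exists (span s); apply/seteqP; split => [y /= ys|y /= [r rA yr]]; first by exists s.
have srA v : v \in s ++ r -> A v by rewrite mem_cat => /orP[/sA|/rA].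
have ssr : (span s <= span (s ++ r))%VS by rewrite span_cat addvSl.
have : span s == span (s ++ r).
  rewrite eqEdim ssr /= sk; apply: kmax.
  by apply/asboolP; exists (s ++ r).
by move=> /eqP ->; rewrite span_cat (subvP (addvSr _ _)).
Qed.

End Span.

Section Euclidean.
Context {R : realType} {n : nat}.

Definition dotv (u v : 'rV[R]_n) : R := \sum_i u 0 i * v 0 i.

(* The inner product a subspace inherits from [R^n]. *)
Definition subdot (X : {vspace 'rV[R]_n}) (u v : subvs_of X) : R :=
  dotv (vsval u) (vsval v).

End Euclidean.

Arguments subdot {R n} X u v.

Section SubspaceNorm.
Context {R : realType} {n : nat} (X : {vspace 'rV[R]_n}).

(* This norm only serves to make [differentiable] meaningful on [X] and is the
   restriction of the library's (maximum) norm of ['rV[R]_n]; in finite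
   dimension differentiability does not depend on the norm.  Lengths are
   always measured with [ipnorm] below. *)
Let sub_norm (u : subvs_of X) : R := `|vsval u|.

Let sub_normD u v : sub_norm (u + v) <= sub_norm u + sub_norm v.
Proof. by rewrite /sub_norm linearD ler_normD. Qed.

Let sub_normZ (l : R) u : sub_norm (l *: u) = `|l| * sub_norm u.
Proof. by rewrite /sub_norm linearZ normrZ. Qed.

Let sub_norm0 u : sub_norm u = 0 -> u = 0.
Proof. by move=> /normr0_eq0 u0; exact: val_inj. Qed.

HB.instance Definition _ :=
  Lmodule_isNormed.Build R (subvs_of X) sub_normD sub_normZ sub_norm0.

End SubspaceNorm.

Section Gradient.
Context {R : realType} {V : normedModType R} (ip : V -> V -> R).

Definition ipnorm (u : V) : R := Num.sqrt (ip u u).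

(* The Riesz representative of the differential, see [gradient_dotvP] and
   [gradient_subdotP]. *)
Definition gradient (f : V -> R) (x : V) : V :=
  xget 0 [set g | forall h, 'd (f : V -> R^o) x h = ip g h].

Definition C11loc (f : V -> R) : Prop :=
  (forall x, differentiable (f : V -> R^o) x) /\
  forall (c : V) (r : R), exists L : R, forall u v : V,
    ipnorm (u - c) <= r -> ipnorm (v - c) <= r ->
    ipnorm (gradient f u - gradient f v) <= L * ipnorm (u - v).

End Gradient.

Section Projection.
Context {R : realType} {n : nat}.
Implicit Types (u v x : 'rV[R]_n) (X : {vspace 'rV[R]_n}).

(* See [orth_projP]. *)
Definition orth_proj X (x : 'rV[R]_n) : subvs_of X :=
  xget 0 [set u : subvs_of X |
    forall v : subvs_of X, dotv (x - vsval u) (vsval v) = 0].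

Lemma dotvC u v : dotv u v = dotv v u.
Proof. by apply: eq_bigr => i _; rewrite mulrC. Qed.

Lemma dotvDl u v x : dotv (u + v) x = dotv u x + dotv v x.
Proof. by rewrite -big_split; apply: eq_bigr => i _; rewrite mxE mulrDl. Qed.

Lemma dotvZl (a : R) u v : dotv (a *: u) v = a * dotv u v.
Proof. by rewrite mulr_sumr; apply: eq_bigr => i _; rewrite mxE mulrA. Qed.

Lemma dotvBl u v x : dotv (u - v) x = dotv u x - dotv v x.
Proof. by rewrite dotvDl -scaleN1r dotvZl mulN1r. Qed.

Lemma dotv_eq0 u : dotv u u = 0 -> u = 0.
Proof.
move=> u0; apply/rowP => i; rewrite mxE; apply/eqP.
have : u 0 i * u 0 i == 0.
  by move/eqP: u0; rewrite psumr_eq0 => [/allP/(_ i)|j _];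
    [apply; rewrite mem_index_enum|rewrite -expr2 sqr_ge0].
by rewrite mulf_eq0 orbb.
Qed.

Lemma dotv_mulmx u v : u *m v^T = (dotv u v)%:M.
Proof.
apply/matrixP => i j; rewrite !ord1 !mxE eqxx mulr1n.
by apply: eq_bigr => k _; rewrite mxE.
Qed.

Lemma orth_projP X x (v : subvs_of X) :
  dotv (x - vsval (orth_proj X x)) (vsval v) = 0.
Proof.
suff [u uP] : exists u : subvs_of X,
    forall v : subvs_of X, dotv (x - vsval u) (vsval v) = 0.
  exact: (@xgetI _ 0 [set u : subvs_of X |
    forall v : subvs_of X, dotv (x - vsval u) (vsval v) = 0] u uP v).
pose B : 'M[R]_(\dim X, n) := \matrix_i (vbasis X)`_i.
have BX (a : 'rV[R]_(\dim X)) : a *m B = \sum_i a 0 i *: (vbasis X)`_i.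
  by rewrite mulmx_sum_row; apply: eq_bigr => i _; rewrite rowK.
have Bfree (a : 'rV[R]_(\dim X)) : a *m B = 0 -> a = 0.
  rewrite BX => a0; apply/rowP => i; rewrite mxE.
  have /freeP := basis_free (vbasisP X); exact.
have BBu : B *m B^T \in unitmx.
  rewrite -row_free_unit -kermx_eq0; apply/rowV0P => a /sub_kermxP.
  rewrite mulmxA => a0; apply/Bfree/dotv_eq0.
  have := dotv_mulmx (a *m B) (a *m B).
  rewrite trmx_mul mulmxA a0 mul0mx => /matrixP/(_ 0 0).
  by rewrite !mxE eqxx mulr1n => <-.
pose c := x *m B^T *m invmx (B *m B^T).
have cX : c *m B \in X.
  rewrite BX; apply: memv_suml => i _.
  by rewrite memvZ// vbasis_mem// mem_nth// size_tuple.
exists (vsproj X (c *m B)) => w; rewrite vsprojK//.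
have [b wE] : exists b : 'rV[R]_(\dim X), vsval w = b *m B.
  exists (\row_i coord (vbasis X) i (vsval w)); rewrite BX.
  rewrite {1}(coord_vbasis (subvsP w)).
  by apply: eq_bigr => i _; rewrite mxE.
have : (x - c *m B) *m (vsval w)^T = 0.
  rewrite wE trmx_mul mulmxA mulmxBl -(mulmxA c) mulmxKV// subrr.
  by rewrite mul0mx.
by rewrite dotv_mulmx => /matrixP/(_ 0 0); rewrite !mxE eqxx mulr1n.
Qed.

End Projection.

Section GradientSpec.
Context {R : realType} {n : nat}.

Lemma gradient_dotvP (f : 'rV[R]_n -> R) (x h : 'rV[R]_n) :
  'd (f : _ -> R^o) x h = dotv (gradient dotv f x) h.
Proof.
apply: (@xgetI _ 0 [set g : 'rV[R]_n |
  forall h, 'd (f : _ -> R^o) x h = dotv g h]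
  (\row_i 'd (f : _ -> R^o) x (delta_mx 0 i))) => k /=.
rewrite {1}[k]row_sum_delta linear_sum; apply: eq_bigr => i _.
by rewrite linearZ mxE mulrC.
Qed.

Lemma gradient_subdotP (X : {vspace 'rV[R]_n}) (f : subvs_of X -> R)
    (x h : subvs_of X) :
  'd (f : _ -> R^o) x h = subdot X (gradient (subdot X) f x) h.
Proof.
pose l := 'd (f : subvs_of X -> R^o) x.
pose g0 : 'rV[R]_n := \row_i l (vsproj X (projv X (delta_mx 0 i))).
apply: (@xgetI _ 0 [set g : subvs_of X |
  forall h, 'd (f : _ -> R^o) x h = subdot X g h] (orth_proj X g0)) => k /=.
rewrite /subdot; have /eqP := orth_projP (X := X) g0 k.
rewrite dotvBl subr_eq0 => /eqP <-.
have {1}-> : k = \sum_i vsval k 0 i *: vsproj X (projv X (delta_mx 0 i)).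
  apply/val_inj; rewrite /= linear_sum /=.
  rewrite -[LHS](projv_id (subvsP k)) {1}[vsval k]row_sum_delta linear_sum.
  by apply: eq_bigr => i _; rewrite !linearZ /= vsprojK// memv_proj.
rewrite linear_sum; apply: eq_bigr => i _.
by rewrite linearZ mxE mulrC.
Qed.

End GradientSpec.

Section Statement.
Context {R : realType} {n : nat}.
Local Notation V := 'rV[R]_n.

Definition convex (F : V -> R) : Prop :=
  convex_function setT (F : convex_lmodType V -> R^o).

Definition convex_envelope (g : V -> R) (x : V) : R :=
  sup [set phi x | phi in
    [set phi : V -> R | convex phi /\ forall y, phi y <= g y]].

Definition subdifferential (F : V -> R) (x : V) : set V :=
  [set u | forall y, F x + dotv u (y - x) <= F y].

(* The subspace [X_F]. *)
Definition subdiff_span (F : V -> R) : {vspace V} :=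
  setspan [set z | exists x y u w,
    [/\ subdifferential F x u, subdifferential F y w & z = u - w]].

(* Only the values on [A] of a jet [(t, xi)] given on a set [A] are
   meaningful. *)
Definition jet_span (A : set V) (xi : V -> V) : {vspace V} :=
  setspan [set xi y - xi z | y in A & z in A].

Definition C11_convex_extension (E : set V) (f : V -> R) (G : V -> V)
    (X : {vspace V}) (F : V -> R) : Prop :=
  [/\ convex F, C11loc dotv F,
      forall y, E y -> F y = f y,
      forall y, E y -> gradient dotv F y = G y
    & subdiff_span F = X].

Definition lipschitz_quotients (A : set V) (X : {vspace V})
    (phi : V -> subvs_of X -> R) (r : R) : set R :=
  let nabla := gradient (subdot X) in
  let norm := ipnorm (subdot X) in
  [set q | exists (y : V) (u v : subvs_of X),
    [/\ A y, norm (orth_proj X y) <= r, norm u <= r, norm v <= r &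
        u != v /\ q = norm (nabla (phi y) u - nabla (phi y) v) / norm (u - v)]].

Definition whitney_condition (A : set V) (t : V -> R) (xi : V -> V)
    (X : {vspace V}) (phi : V -> subvs_of X -> R) : Prop :=
  let P := orth_proj X in
  let nabla := gradient (subdot X) in
  [/\ forall y, A y -> (forall u, 0 <= phi y u) /\ C11loc (subdot X) (phi y),
      jet_span A xi = X,
      forall y, A y -> phi y (P y) = 0 /\ nabla (phi y) (P y) = 0,
      forall r : R, 0 < r ->
        (ereal_sup (EFin @` lipschitz_quotients A phi r) < +oo)%E
    & forall z y, A z -> A y -> forall x,
        t z + dotv (xi z) (x - z) <= t y + dotv (xi y) (x - y) + phi y (P x)].

(* [(t, xi)] is the jet [(f, G)] on [E] together with the data
   [(beta j, w j)] at the new points [p j]. *)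
Definition adjoined_jet (E : set V) (f : V -> R) (G : V -> V) (m : nat)
    (p : 'I_m -> V) (beta : 'I_m -> R) (w : 'I_m -> V)
    (t : V -> R) (xi : V -> V) : Prop :=
  [/\ forall j, ~ E (p j),
      forall y, E y -> t y = f y /\ xi y = G y
    & forall j, t (p j) = beta j /\ xi (p j) = w j].

Definition upper_values (A : set V) (t : V -> R) (xi : V -> V)
    (X : {vspace V}) (phi : V -> subvs_of X -> R) (a : R) (x : V) : set R :=
  [set t y + dotv (xi y) (x - y) + phi y (orth_proj X x)
       + a * ipnorm (subdot X) (orth_proj X (x - y)) ^+ 2 | y in A].

(* The real-valued [inf] and [sup] involved are those of nonempty bounded sets,
   see [has_inf_upper_values] and [has_sup_convex_envelope]. *)
Definition extension_formula (A : set V) (t : V -> R) (xi : V -> V)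
    (X : {vspace V}) (phi : V -> subvs_of X -> R) (a : R) : V -> R :=
  convex_envelope (fun x => inf (upper_values A t xi phi a x)).

Section WellDefined.
Variables (A : set V) (t : V -> R) (xi : V -> V) (X : {vspace V}).
Variables (phi : V -> subvs_of X -> R) (a : R).
Hypotheses (A0 : A !=set0) (wA : whitney_condition A t xi phi) (a0 : 0 < a).

Let lb_upper_values z x : A z ->
  lbound (upper_values A t xi phi a x) (t z + dotv (xi z) (x - z)).
Proof.
move=> Az _ [y Ay <-]; have [_ _ _ _ /(_ z y Az Ay x)] := wA.
by move=> /le_trans; apply; rewrite lerDl mulr_ge0 ?sqr_ge0// ltW.
Qed.

Lemma has_inf_upper_values x : has_inf (upper_values A t xi phi a x).
Proof.
have [z Az] := A0; split.
  by eexists; exists z.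
by exists (t z + dotv (xi z) (x - z)); exact: lb_upper_values.
Qed.

Lemma has_sup_convex_envelope x :
  has_sup [set psi x | psi in [set psi : V -> R | convex psi /\
    forall y, psi y <= inf (upper_values A t xi phi a y)]].
Proof.
split; last by exists (inf (upper_values A t xi phi a x)) => _ [psi [_ psile] <-].
have [z Az] := A0; eexists; exists (fun x => t z + dotv (xi z) (x - z)) => //.
split => [l y1 y2 _ _|y]; last first.
  by apply: lb_le_inf; [have [] := has_inf_upper_values y|exact: lb_upper_values].
have -> : ((y1 : convex_lmodType V) <| l |> y2) =
    l%:num *: y1 + (1 - l%:num) *: y2 by [].
rewrite convRE !(dotvC (xi z)) !dotvBl dotvDl !dotvZl.
by rewrite le_eqVlt; apply/orP; left; apply/eqP; rewrite /unstable.onem; ring.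
Qed.

End WellDefined.

End Statement.

(* Main.v *)
Require Import Defs.
From HB Require Import structures.
From mathcomp Require Import all_boot all_order all_algebra.
From mathcomp Require Import all_classical all_reals all_analysis.
From mathcomp Require Import ring lra.
Import Order.TTheory GRing.Theory Num.Theory.
Import numFieldNormedType.Exports.
Local Open Scope classical_set_scope.
Local Open Scope ring_scope.

Set Implicit Arguments.
Unset Strict Implicit.
Unset Printing Implicit Defensive.

(* Sufficiency.  Let [g] be the infimum in the formula for [F].  The quadratic
   term makes all indices [y] with [P y] far from [P x] irrelevant for [g x], so
   that near [x] the function [g] is an infimum of functions with uniformly
   Lipschitz gradients; hence [g (x + w) + g (x - w) - 2 g x <= M |w|^2] locally.
   As the differences of the slopes [xi y] span [X], averaging the affine
   minorants of [g] gives one above which [g] grows at least like [c |P x|].  The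
   graph of [conv g] is then reached by convex combinations carrying at least
   half of their mass in a bounded region; translating only that part transfers
   the second difference bound to [conv g], and a convex function with such a
   bound is [C^{1,1}_loc].  The function [conv g] lies between the affine
   functions of slope [xi y] and [g], and these agree at [y].
   Necessity.  If [F] is an extension, [F x - <G y, x>] only depends on [P x], so
   one can take for [phi y] the remainder [F - F (P y) - <G y, _ - P y>] of the
   first-order expansion of [F] at [P y], restricted to [X]. *)

(** * Euclidean inner product and orthogonal projection onto a subspace *)

Section InnerProduct.
Context {R : realType} {n : nat}.
Implicit Types (u v x y z : 'rV[R]_n) (X : {vspace 'rV[R]_n}).

Lemma dotv0l u : dotv 0 u = 0.
Proof. by rewrite -(scale0r 0) dotvZl mul0r. Qed.

Lemma dotvNl u v : dotv (- u) v = - dotv u v.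
Proof. by rewrite -scaleN1r dotvZl mulN1r. Qed.

Lemma dotv0r u : dotv u 0 = 0. Proof. by rewrite dotvC dotv0l. Qed.

Lemma dotvDr u v x : dotv x (u + v) = dotv x u + dotv x v.
Proof. by rewrite dotvC dotvDl !(dotvC x). Qed.

Lemma dotvZr (a : R) u v : dotv u (a *: v) = a * dotv u v.
Proof. by rewrite dotvC dotvZl (dotvC u). Qed.

Lemma dotvNr u v : dotv u (- v) = - dotv u v.
Proof. by rewrite dotvC dotvNl (dotvC u). Qed.

Lemma dotvBr u v x : dotv x (u - v) = dotv x u - dotv x v.
Proof. by rewrite dotvDr dotvNr. Qed.

Lemma dotv_suml (I : Type) (r : seq I) (P : pred I) (F : I -> 'rV[R]_n) v :
  dotv (\sum_(i <- r | P i) F i) v = \sum_(i <- r | P i) dotv (F i) v.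
Proof. by apply: (big_morph (dotv^~ v) (fun x y => dotvDl x y v) (dotv0l v)). Qed.

Lemma dotv_ge0 u : 0 <= dotv u u.
Proof. by apply: sumr_ge0 => i _; rewrite -expr2 sqr_ge0. Qed.

Local Notation "`| u |_2" := (ipnorm dotv u) (format "`| u |_2").

Lemma norm2_ge0 u : 0 <= `|u|_2. Proof. exact: sqrtr_ge0. Qed.

Lemma sqr_norm2 u : `|u|_2 ^+ 2 = dotv u u.
Proof. by rewrite sqr_sqrtr// dotv_ge0. Qed.

Lemma norm2Z (a : R) u : `|a *: u|_2 = `|a| * `|u|_2.
Proof.
by rewrite /ipnorm dotvZl dotvZr mulrA -expr2 sqrtrM ?sqr_ge0// sqrtr_sqr.
Qed.

Lemma norm2N u : `|- u|_2 = `|u|_2.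
Proof. by rewrite -scaleN1r norm2Z normrN1 mul1r. Qed.

Lemma norm2_0 : `|0 : 'rV[R]_n|_2 = 0.
Proof. by rewrite -(scale0r 0) norm2Z normr0 mul0r. Qed.

Lemma norm2_eq0 u : `|u|_2 = 0 -> u = 0.
Proof. by move=> u0; apply: dotv_eq0; rewrite -sqr_norm2 u0 expr0n. Qed.

Lemma norm2_distC u v : `|u - v|_2 = `|v - u|_2.
Proof. by rewrite -opprB norm2N. Qed.

Lemma cauchy_schwarz u v : dotv u v <= `|u|_2 * `|v|_2.
Proof.
have [->|v0] := eqVneq v 0; first by rewrite dotv0r mulr_ge0// norm2_ge0.
have vv : 0 < dotv v v.
  by rewrite lt_neqAle dotv_ge0 andbT eq_sym; apply: contra_neq v0; exact: dotv_eq0.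
rewrite (le_trans (ler_norm _))// -ler_sqr ?nnegrE ?mulr_ge0 ?norm2_ge0//.
rewrite exprMn !sqr_norm2 -normrX ger0_norm ?sqr_ge0//.
have := dotv_ge0 (dotv v v *: u - dotv u v *: v).
rewrite dotvBl !dotvBr !dotvZl !dotvZr (dotvC v u) => h.
have : 0 <= dotv v v * (dotv u u * dotv v v - dotv u v ^+ 2).
  by apply: le_trans h _; rewrite le_eqVlt; apply/orP; left; apply/eqP; ring.
by rewrite pmulr_rge0// subr_ge0.
Qed.

Lemma cauchy_schwarz_norm u v : `|dotv u v| <= `|u|_2 * `|v|_2.
Proof.
rewrite ler_norml cauchy_schwarz andbT lerNl -dotvNl.
by rewrite (le_trans (cauchy_schwarz _ _))// norm2N.
Qed.

Lemma norm2D u v : `|u + v|_2 <= `|u|_2 + `|v|_2.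
Proof.
rewrite -ler_sqr ?nnegrE ?addr_ge0 ?norm2_ge0// sqr_norm2 sqrrD !sqr_norm2.
rewrite dotvDl !dotvDr (dotvC v u).
by have := cauchy_schwarz u v; lra.
Qed.

Lemma norm2_le_mx u : `|u|_2 <= (n%:R + 1) * `|u|.
Proof.
have n1 : 0 <= n%:R + 1 :> R by rewrite addr_ge0.
rewrite -ler_sqr ?nnegrE ?norm2_ge0 ?mulr_ge0// sqr_norm2 exprMn.
apply: (@le_trans _ _ (n%:R * `|u| ^+ 2)).
  rewrite -[n in n%:R]card_ord mulr_natl -sumr_const ler_sum// => i _.
  rewrite -expr2 -[leLHS]ger0_norm ?sqr_ge0// normrX.
  rewrite ler_sqr ?nnegrE//.
  rewrite [leRHS]/Num.Def.normr/= mx_normrE.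
  exact: (le_bigmax 0 (fun ij : 'I_1 * 'I_n => `|u ij.1 ij.2|) (0, i)).
apply: ler_wpM2r; first exact: sqr_ge0.
by have := ler0n R n; nra.
Qed.

Lemma linear_formE (l : 'rV[R]_n -> R) : (forall u v, l (u + v) = l u + l v) ->
  (forall (a : R) u, l (a *: u) = a * l u) ->
  forall u, l u = dotv (\row_i l (delta_mx 0 i)) u.
Proof.
move=> lD lZ u; have l0 : l 0 = 0 by rewrite -(scale0r 0) lZ mul0r.
rewrite {1}[u]row_sum_delta (big_morph l lD l0); apply: eq_bigr => i _.
by rewrite lZ mxE mulrC.
Qed.

Section OrthProj.
Variable X : {vspace 'rV[R]_n}.
Local Notation P := (orth_proj X).

Lemma orth_proj_unique x (u : subvs_of X) :
  (forall v : subvs_of X, dotv (x - vsval u) (vsval v) = 0) -> P x = u.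
Proof.
move=> xu; apply/eqP; rewrite -subr_eq0; apply/eqP/val_inj/dotv_eq0 => /=.
have := orth_projP x (P x - u); have := xu (P x - u).
by rewrite /= !dotvBl => h1 h2; lra.
Qed.

Lemma orth_projD x y : P (x + y) = P x + P y.
Proof.
apply: orth_proj_unique => v /=; rewrite opprD addrACA dotvDl.
by rewrite !orth_projP addr0.
Qed.

Lemma orth_projZ (a : R) x : P (a *: x) = a *: P x.
Proof.
apply: orth_proj_unique => v.
have -> : a *: x - vsval (a *: P x) = a *: (x - vsval (P x)).
  by rewrite scalerBr linearZ.
by rewrite dotvZl orth_projP mulr0.
Qed.

Lemma orth_projN x : P (- x) = - P x.
Proof. by rewrite -scaleN1r orth_projZ scaleN1r. Qed.

Lemma orth_projB x y : P (x - y) = P x - P y.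
Proof. by rewrite orth_projD orth_projN. Qed.

Lemma orth_proj_id (u : subvs_of X) : P (vsval u) = u.
Proof. by apply: orth_proj_unique => v; rewrite subrr dotv0l. Qed.

Lemma dotv_orth_proj x y : x \in X -> dotv x (vsval (P y)) = dotv x y.
Proof.
move=> xX; apply/eqP; rewrite eq_sym -subr_eq0 -dotvBr dotvC.
by rewrite -(vsprojK xX) orth_projP.
Qed.

Local Notation N x := (ipnorm (subdot X) (P x)).

Lemma subnormE (u : subvs_of X) : ipnorm (subdot X) u = `|vsval u|_2.
Proof. by []. Qed.

Lemma projnormD x y : N (x + y) <= N x + N y.
Proof. by rewrite orth_projD !subnormE linearD norm2D. Qed.

Lemma projnormZ (a : R) x : N (a *: x) = `|a| * N x.
Proof. by rewrite orth_projZ !subnormE linearZ norm2Z. Qed.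

Lemma projnorm_ge0 x : 0 <= N x. Proof. exact: norm2_ge0. Qed.

Lemma projnorm_le x : N x <= `|x|_2.
Proof.
rewrite subnormE -ler_sqr ?nnegrE ?norm2_ge0// !sqr_norm2.
have px : dotv (x - vsval (P x)) (vsval (P x)) = 0 by exact: orth_projP.
have := dotv_ge0 (x - vsval (P x)).
move: px; rewrite !dotvBr !dotvBl (dotvC _ x) => px.
by lra.
Qed.

End OrthProj.
End InnerProduct.

(** * Gradients recognised from a quadratic remainder *)

Lemma differentiable_quadratic (R : realType) (V W : normedModType R)
    (f : V -> W) (df : {linear V -> W}) (x : V) (M : R) : continuous df ->
  (\forall v \near (0 : V), `|f (x + v) - f x - df v| <= M * `|v| ^+ 2) ->
  differentiable f x /\ 'd f x = df :> (V -> W).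
Proof.
move=> dfc fM.
have fo : f \o shift x = cst (f x) + df +o_ 0 id.
  apply/eqaddoP => e e0; near=> v.
  rewrite [X in `|X|](_ : _ = f (x + v) - f x - df v); last first.
    by rewrite /= opprD addrA !fctE/= (addrC v x).
  have vM : `|v| <= e / (`|M| + 1).
    by near: v; apply: nbhs0_le; rewrite divr_gt0// ltr_wpDl.
  rewrite ler_pdivlMr ?ltr_wpDl// in vM.
  apply: (@le_trans _ _ (M * `|v| ^+ 2)); first by near: v.
  have := ler_norm M; have := normr_ge0 v; rewrite /= => v0 MM; nra.
have dE : 'd f x = df :> (V -> W) by exact: diff_unique fo.
by split=> //; apply/diff_locallyP; rewrite dE.
Unshelve. all: by end_near. Qed.

(** A remainder of order [|v|^2] identifies the differential, and nondegeneracy of [ip] then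
    identifies the gradient. The inner product is kept abstract so that the result serves both the
    whole space and a subspace [X]; [K] compares [ipnorm] with the norm that defines
    differentiability. *)
Lemma gradient_quadratic (R : realType) (V : normedModType R)
    (ip : V -> V -> R) (K : R) (f : V -> R) (x p : V) (M : R) :
  (forall u, linear (ip u : V -> R^o)) ->
  (forall u v w, ip (u - v) w = ip u w - ip v w) ->
  (forall u, ip u u = 0 -> u = 0) ->
  (forall u v, `|ip u v| <= ipnorm ip u * ipnorm ip v) ->
  (forall u, ipnorm ip u <= K * `|u|) ->
  (forall (f : V -> R) x h, 'd (f : _ -> R^o) x h = ip (gradient ip f x) h) ->
  (forall v, ipnorm ip v <= 2^-1 ->
     `|f (x + v) - f x - ip p v| <= M * ipnorm ip v ^+ 2) ->
  differentiable (f : _ -> R^o) x /\ gradient ip f x = p.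
Proof.
move=> ip_lin ipBl ip_eq0 ip_le norm_le gradE fM.
pose pM := GRing.isLinear.Build _ _ _ _ _ (ip_lin p).
pose pL : {linear V -> R^o} := HB.pack (ip p : V -> R^o) pM.
have norm_ge0 u : 0 <= ipnorm ip u by exact: sqrtr_ge0.
have norm_le' u : ipnorm ip u <= (`|K| + 1) * `|u|.
  by apply: le_trans (norm_le u) _; rewrite ler_wpM2r//; have := ler_norm K; lra.
have K0 : 0 < `|K| + 1 by rewrite ltr_wpDl.
have [||df dfE] := @differentiable_quadratic _ _ _ (f : _ -> R^o) pL x
    (`|M| * (`|K| + 1) ^+ 2).
- apply: bounded_linear_continuous; apply/linear_boundedP.
  exists (ipnorm ip p * (`|K| + 1)); split; first exact: num_real.
  move=> r pr v; apply: le_trans (ip_le p v) _.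
  apply: le_trans (ler_wpM2l (norm_ge0 p) (norm_le' v)) _.
  by rewrite mulrA ler_wpM2r// ltW.
- near=> v.
  have v1 : `|v| <= (2 * (`|K| + 1))^-1.
    by near: v; apply: (@nbhs0_le R V); rewrite invr_gt0 mulr_gt0.
  apply: le_trans (fM v _) _.
    by apply: le_trans (norm_le' v) _; rewrite invfM in v1; rewrite mulrC -ler_pdivlMr.
  rewrite -mulrA -exprMn (@le_trans _ _ (`|M| * ipnorm ip v ^+ 2))//.
    by rewrite ler_wpM2r ?sqr_ge0 ?ler_norm.
  by rewrite ler_wpM2l// ler_sqr ?nnegrE// mulr_ge0// ltW.
split=> //.
apply/eqP; rewrite -subr_eq0; apply/eqP/ip_eq0; rewrite ipBl.
by rewrite -gradE dfE subrr.
Unshelve. all: by end_near. Qed.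

Section ConvexFunctions.
Context {R : realType} {n : nat}.
Implicit Types (u v w x y z : 'rV[R]_n) (X : {vspace 'rV[R]_n}).
Implicit Types F : 'rV[R]_n -> R.
Local Notation "`| u |_2" := (ipnorm dotv u) (format "`| u |_2").

Lemma convexP F : convex F <-> forall x y (t : R), 0 <= t <= 1 ->
  F (t *: x + (1 - t) *: y) <= t * F x + (1 - t) * F y.
Proof.
split=> [cF x y t /andP[t0 t1]|cF t x y _ _]; last first.
  have := cF x y t%:num; apply; exact/andP.
by have := cF (Itv01 t0 t1) x y (in_setT _) (in_setT _).
Qed.

Lemma convex_midpoint F : convex F -> forall x y,
  F (2^-1 *: (x + y)) <= 2^-1 * (F x + F y).
Proof.
move=> /convexP cF x y; have := cF x y 2^-1.
have -> : 1 - 2^-1 = 2^-1 :> R by lra.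
by rewrite scalerDr mulrDr; apply; lra.
Qed.

Lemma gradient_dotv_quadratic F x p (M : R) :
  (forall v, `|v|_2 <= 2^-1 ->
     `|F (x + v) - F x - dotv p v| <= M * `|v|_2 ^+ 2) ->
  differentiable (F : _ -> R^o) x /\ gradient dotv F x = p.
Proof.
apply: (gradient_quadratic (K := n%:R + 1)).
- by move=> u b v w; rewrite dotvDr dotvZr.
- exact: dotvBl.
- exact: dotv_eq0.
- exact: cauchy_schwarz_norm.
- exact: norm2_le_mx.
- exact: gradient_dotvP.
Qed.

Lemma gradient_subdot_quadratic X (phi : subvs_of X -> R) (x p : subvs_of X)
    (M : R) :
  (forall v : subvs_of X, ipnorm (subdot X) v <= 2^-1 ->
     `|phi (x + v) - phi x - subdot X p v| <= M * ipnorm (subdot X) v ^+ 2) ->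
  differentiable (phi : _ -> R^o) x /\ gradient (subdot X) phi x = p.
Proof.
apply: (gradient_quadratic (K := n%:R + 1)).
- by move=> u b v w; rewrite /subdot linearD linearZ dotvDr dotvZr.
- by move=> u v w; rewrite /subdot linearB dotvBl.
- by move=> u /dotv_eq0 u0; exact: val_inj.
- by move=> u v; exact: cauchy_schwarz_norm.
- by move=> u; exact: norm2_le_mx.
- exact: gradient_subdotP.
Qed.

End ConvexFunctions.

(** * Existence of subgradients under a second difference bound *)

Section SubgradientExistence.
Context {R : realType} {n : nat}.
Implicit Types (u v w x y z : 'rV[R]_n) (t s : R).
Variables (F : 'rV[R]_n -> R) (x : 'rV[R]_n).
Hypothesis cF : convex F.

Let q v t := (F (x + t *: v) - F x) / t.
(** Since the quotients are monotone in [t] ([q_mono]), this infimum is the one-sided directional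
    derivative of [F] at [x] along [v]. *)
Let D v := inf [set q v t | t in [set t | 0 < t]].

Let q_mono v s t : 0 < s -> s <= t -> q v s <= q v t.
Proof.
move=> s0 st; have t0 : 0 < t by exact: lt_le_trans st.
have /(convexP F).1 := cF => /(_ (x + t *: v) x (s / t)).
have -> : s / t *: (x + t *: v) + (1 - s / t) *: x = x + s *: v.
  rewrite scalerDr addrAC -scalerDl [s / t + _]addrC subrK scale1r.
  by rewrite scalerA divfK// gt_eqF.
move=> /(_ _)/wrap[|h].
  by rewrite divr_ge0 ?(ltW s0) ?(ltW t0)//= ler_pdivrMr// mul1r.
rewrite /q ler_pdivrMr// mulrAC -mulrA mulrC.
apply: le_trans (_ : s / t * F (x + t *: v) + (1 - s / t) * F x - F x <= _).
  by rewrite lerD2r.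
by lra.
Qed.

(** [x] is the convex combination of [x - v] and [x + t *: v] with weights [t / (1 + t)] and
    [(1 + t)^-1]. The bound is independent of [t], which makes [D v] a genuine infimum. *)
Let q_lb v t : 0 < t -> F x - F (x - v) <= q v t.
Proof.
move=> t0; rewrite /q ler_pdivlMr//.
have t1 : 0 < 1 + t by rewrite addr_gt0.
have /(convexP F).1 := cF => /(_ (x - v) (x + t *: v) (t / (1 + t))).
have t2 : 1 - t / (1 + t) = (1 + t)^-1.
  by apply: (mulIf (lt0r_neq0 t1)); rewrite mulrBl divfK ?mulVf ?gt_eqF//; lra.
rewrite t2.
have -> : t / (1 + t) *: (x - v) + (1 + t)^-1 *: (x + t *: v) = x.
  rewrite mulrC -scalerA -scalerDr scalerBr addrACA [- _ + _]addrC subrr addr0.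
  by rewrite -{2}(scale1r x) -scalerDl scalerA addrC mulVf ?scale1r ?gt_eqF// addrC.
move=> /(_ _)/wrap[|h].
  by rewrite divr_ge0 ?(ltW t0) ?(ltW t1)//= ler_pdivrMr// mul1r; lra.
have : F x * (1 + t) <= t * F (x - v) + F (x + t *: v).
  rewrite -ler_pdivlMr//; apply: le_trans h _.
  by rewrite le_eqVlt; apply/orP; left; apply/eqP; field; rewrite gt_eqF.
by lra.
Qed.

Let has_inf_q v : has_inf [set q v t | t in [set t | 0 < t]].
Proof.
split; first by exists (q v 1), 1 => //=.
by exists (F x - F (x - v)) => _ [t /= t0 <-]; exact: q_lb.
Qed.

Let D_le v t : 0 < t -> D v <= q v t.
Proof. by move=> t0; apply: ge_inf; [have [] := has_inf_q v|exists t]. Qed.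

Let D_near v e : 0 < e -> exists2 d, 0 < d &
  forall t, 0 < t -> t <= d -> q v t < D v + e.
Proof.
move=> e0; have [_ [d /= d0 <-] qd] := inf_adherent e0 (has_inf_q v).
by exists d => // t t0 td; apply: le_lt_trans qd; exact: q_mono.
Qed.

(** Midpoint convexity between [x + t *: u] and [x + t *: v] bounds the quotient of [u + v] at
    [t / 2] by the sum of the quotients of [u] and [v] at [t]. *)
Let D_subadd u v : D (u + v) <= D u + D v.
Proof.
apply/ler_addgt0Pr => e e0.
have e2 : 0 < e / 2 by rewrite divr_gt0.
have [d1 d10 h1] := D_near u e2; have [d2 d20 h2] := D_near v e2.
pose t := Num.min d1 d2; have t0 : 0 < t by rewrite lt_min d10.
have t2 : 0 < t / 2 by rewrite divr_gt0.
have := h1 t t0 (_ : t <= d1); rewrite ge_min lexx => /(_ isT) {}h1.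
have := h2 t t0 (_ : t <= d2); rewrite ge_min lexx orbT => /(_ isT) {}h2.
apply: le_trans (D_le _ t2) _.
suff : q (u + v) (t / 2) <= q u t + q v t by lra.
rewrite /q -mulrDl ler_pdivrMr//.
have tt S : S / t * (t / 2) = S / 2 by field; rewrite gt_eqF.
rewrite tt.
have := convex_midpoint cF (x + t *: u) (x + t *: v).
have -> : 2^-1 *: (x + t *: u + (x + t *: v)) = x + (t / 2) *: (u + v).
  rewrite addrACA -[x + x]/(x *+ 2) -(scaler_nat 2 x) scalerDr scalerA mulVf//.
  by rewrite scale1r -scalerDr scalerA [t / 2]mulrC.
by lra.
Qed.

Let q_scale c v t : 0 < c -> 0 < t -> q (c *: v) t = c * q v (c * t).
Proof.
move=> c0 t0; rewrite /q scalerA (mulrC t); field.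
by rewrite !gt_eqF.
Qed.

Let D_scale_le c v : 0 < c -> D (c *: v) <= c * D v.
Proof.
move=> c0; rewrite mulrC -ler_pdivrMr//; apply: lb_le_inf; first by have [] := has_inf_q v.
move=> _ [t /= t0 <-]; rewrite ler_pdivrMr// mulrC.
have tc : 0 < t / c by rewrite divr_gt0.
by apply: le_trans (D_le _ tc) _; rewrite q_scale// (mulrC c (t / c)) divfK ?gt_eqF.
Qed.

Let D_scale c v : 0 < c -> D (c *: v) = c * D v.
Proof.
move=> c0; apply/eqP; rewrite eq_le D_scale_le//=.
have ci : 0 < c^-1 by rewrite invr_gt0.
have := D_scale_le (c *: v) ci; rewrite scalerA mulVf ?gt_eqF// scale1r.
by rewrite ler_pdivlMl.
Qed.

Let D0 : D 0 = 0.
Proof.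
have : D (2 *: 0) = 2 * D 0 by exact: D_scale.
by rewrite scaler0; lra.
Qed.

Variable M : R.
Hypothesis FM : forall v, ipnorm dotv v <= 2^-1 ->
  F (x + v) + F (x - v) <= 2 * F x + M * ipnorm dotv v ^+ 2.

(** One inequality is subadditivity. For the other, the second difference bound makes the quotients
    along [v] and [- v] cancel up to a term of order [t]. *)
Let D_opp v : D (- v) = - D v.
Proof.
have h : 0 <= D v + D (- v) by rewrite -D0 -(subrr v) D_subadd.
suff : D v + D (- v) <= 0 by lra.
apply/ler_addgt0Pr => e e0; rewrite add0r.
pose N := ipnorm dotv v; have N0 : 0 <= N by exact: norm2_ge0.
(* The first entry puts [t *: v] within the radius 1/2 where [FM] applies, the second makes
   [M * t * N ^+ 2] at most [e]. *)
pose t := Num.min (2 * (N + 1))^-1 (e / (`|M| * N ^+ 2 + 1)).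
have MN : 0 < `|M| * N ^+ 2 + 1 by rewrite ltr_wpDl// mulr_ge0// sqr_ge0.
have t0 : 0 < t by rewrite lt_min invr_gt0 divr_gt0// andbT mulr_gt0// ltr_wpDl.
apply: le_trans (lerD (D_le v t0) (D_le (- v) t0)) _.
rewrite /q -mulrDl ler_pdivrMr// scalerN.
have tN : ipnorm dotv (t *: v) = t * N by rewrite norm2Z gtr0_norm.
have t1 : t <= (2 * (N + 1))^-1 by rewrite ge_min lexx.
have t2 : t <= e / (`|M| * N ^+ 2 + 1) by rewrite ge_min lexx orbT.
have := FM (v := t *: v); rewrite tN => /(_ _)/wrap[|h2].
  have := ler_pM (ltW t0) N0 t1 (lexx N); move=> /le_trans; apply.
  rewrite mulrC ler_pdivrMr ?mulr_gt0 ?ltr_wpDl//; lra.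
rewrite ler_pdivlMr// in t2.
have : M * (t * N) ^+ 2 <= e * t.
  have MM := ler_norm M; have N2 := sqr_ge0 N.
  apply: (@le_trans _ _ (t * (`|M| * N ^+ 2 + 1) * t)); last by rewrite ler_pM2r.
  have : 0 <= t * t * ((`|M| - M) * N ^+ 2 + 1).
    apply: mulr_ge0; first by rewrite mulr_ge0// ltW.
    by rewrite addr_ge0// mulr_ge0// subr_ge0.
  by lra.
by lra.
Qed.

(** By [D_subadd], [D_opp] and [D_scale] the directional derivative is itself linear, so it is given
    by a vector; [D v <= q v 1] is the subgradient inequality. *)
Lemma subgradient_exists : exists p, forall v, F x + dotv p v <= F (x + v).
Proof.
exists (\row_i D (delta_mx 0 i)) => v; rewrite -linear_formE.
- by have := D_le v ltr01; rewrite /q scale1r divr1; lra.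
- move=> u w; apply/eqP; rewrite eq_le D_subadd/=.
  by have := D_subadd (u + w) (- w); rewrite addrK D_opp; lra.
- move=> a u; have [a0|a0|->] := ltgtP a 0; last 1 first.
  + by rewrite scale0r mul0r D0.
  + rewrite -[in LHS](opprK a) scaleNr D_opp D_scale ?oppr_gt0//; lra.
  + by rewrite D_scale.
Qed.

End SubgradientExistence.

(** * Convex functions with bounded second differences are locally [C^{1,1}] *)

Section LocallyLipschitzGradient.
Context {R : realType} {n : nat}.
Implicit Types (u v w x y z : 'rV[R]_n) (t s : R).
Variable F : 'rV[R]_n -> R.
Hypothesis cF : convex F.
Hypothesis FM : forall r, exists2 M : R, 0 <= M & forall x v,
  ipnorm dotv x <= r -> ipnorm dotv v <= 2^-1 ->
  F (x + v) + F (x - v) <= 2 * F x + M * ipnorm dotv v ^+ 2.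

(** The subgradient inequality at [- v] bounds [F (x - v)] from below, which turns the second
    difference bound into a one-sided quadratic bound on [F (x + v)]. *)
Let FMx x p (M : R) : (forall v, ipnorm dotv v <= 2^-1 ->
    F (x + v) + F (x - v) <= 2 * F x + M * ipnorm dotv v ^+ 2) ->
  (forall v, F x + dotv p v <= F (x + v)) ->
  forall v, ipnorm dotv v <= 2^-1 ->
     F (x + v) <= F x + dotv p v + M * ipnorm dotv v ^+ 2.
Proof.
by move=> h sp v v2; have := h v v2; have := sp (- v); rewrite dotvNr; lra.
Qed.

Lemma semiconcave_gradient x : differentiable (F : _ -> R^o) x /\
  forall v, F x + dotv (gradient dotv F x) v <= F (x + v).
Proof.
have [M M0 h] := FM (ipnorm dotv x).
have hx v (v2 : ipnorm dotv v <= 2^-1) := h x v (lexx _) v2.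
have [p sp] := subgradient_exists cF hx.
have [|dF ->] := @gradient_dotv_quadratic _ _ F x p M; last by split.
move=> v v2; have := FMx hx sp v2; have := sp v => h1 h2.
by rewrite ger0_norm; lra.
Qed.

Lemma semiconcave_gradient_unique x p :
  (forall v, F x + dotv p v <= F (x + v)) -> gradient dotv F x = p.
Proof.
move=> sp; have [M M0 h] := FM (ipnorm dotv x).
have hx v (v2 : ipnorm dotv v <= 2^-1) := h x v (lexx _) v2.
have [|_ ->//] := @gradient_dotv_quadratic _ _ F x p M.
move=> v v2; have := FMx hx sp v2; have := sp v => h1 h2.
by rewrite ger0_norm; lra.
Qed.

Let close_lip r : exists2 M : R, 0 <= M & forall x y,
  ipnorm dotv x <= r -> ipnorm dotv y <= r -> ipnorm dotv (x - y) <= 2^-1 ->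
  ipnorm dotv (gradient dotv F x - gradient dotv F y) <= M * ipnorm dotv (x - y).
Proof.
have [M M0 h] := FM r; exists (2 * M); first by rewrite mulr_ge0.
move=> x y xr yr xy.
have [->|xy0] := eqVneq x y; first by rewrite !subrr norm2_0 mulr0.
have [_ px] := semiconcave_gradient x; have [_ qy] := semiconcave_gradient y.
move: (gradient dotv F x) (gradient dotv F y) px qy => p q px qy.
have hx v (v2 : ipnorm dotv v <= 2^-1) := h x v xr v2.
have hy v (v2 : ipnorm dotv v <= 2^-1) := h y v yr v2.
have [pq|pq] := eqVneq p q; first by rewrite pq subrr norm2_0 !mulr_ge0// norm2_ge0.
set d := ipnorm dotv (x - y); set c := ipnorm dotv (p - q).
have c0 : 0 < c.
  rewrite lt_neqAle norm2_ge0 andbT eq_sym; apply: contra_neq pq => c0.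
  by apply/eqP; rewrite -subr_eq0; apply/eqP/norm2_eq0.
(* [k] has length [d] and points along [p - q], so [dotv (p - q) k = d * c]. Bounding [F (y + k)]
   below through [p] at [x] and above through [q] at [y] gives [d * c <= 2 * M * d ^+ 2]. *)
pose k := (d / c) *: (p - q).
have kd : ipnorm dotv k = d.
  rewrite norm2Z ger0_norm; first by rewrite divfK// gt_eqF.
  by rewrite divr_ge0 ?norm2_ge0.
have dp : 0 < d.
  rewrite lt_neqAle norm2_ge0 andbT eq_sym; apply: contra_neq xy0 => d0.
  by apply/eqP; rewrite -subr_eq0; apply/eqP/norm2_eq0.
have h1 := FMx hy qy (_ : ipnorm dotv k <= 2^-1); rewrite kd in h1.
have h2 := FMx hx px (_ : ipnorm dotv (y - x) <= 2^-1).
rewrite norm2_distC -/d in h2.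
have := h1 xy; have := h2 xy; rewrite addrC subrK => {}h2 {}h1.
have h3 := px (k + (y - x)).
rewrite (_ : x + (k + (y - x)) = y + k) in h3; last first.
  by rewrite addrC addrA subrK addrC.
rewrite dotvDr in h3.
have : dotv (p - q) k <= 2 * M * d ^+ 2 by rewrite dotvBl; lra.
rewrite dotvZr -sqr_norm2 -/c expr2 mulrA divfK ?gt_eqF// => h4.
rewrite -(ler_pM2l dp); apply: le_trans h4 _.
by rewrite le_eqVlt; apply/orP; left; apply/eqP; ring.
Qed.

(** [close_lip] handles pairs at distance at most 1/2. Bisection extends it to a whole ball:
    midpoints stay in the ball, and the bounds on the two halves add up without loss in the
    constant. *)
Lemma semiconcave_C11loc : C11loc dotv F.
Proof.
split=> [x|c r]; first by have [] := semiconcave_gradient x.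
have [M M0 h] := close_lip (ipnorm dotv c + r); exists M.
have hc x : ipnorm dotv (x - c) <= r -> ipnorm dotv x <= ipnorm dotv c + r.
  by move=> xc; rewrite -(subrK c x) addrC (le_trans (norm2D _ _))// lerD2l.
suff H k : forall x y, ipnorm dotv (x - c) <= r -> ipnorm dotv (y - c) <= r ->
    ipnorm dotv (x - y) <= 2 ^+ k / 2 ->
    ipnorm dotv (gradient dotv F x - gradient dotv F y) <= M * ipnorm dotv (x - y).
  move=> u v uc vc.
  (* Here [2 |u - v| < k <= 2 ^ k] for the chosen number [k] of bisections. *)
  apply: (H (Num.truncn (2 * ipnorm dotv (u - v))).+1) => //.
  rewrite ler_pdivlMr// mulrC ltW//.
  apply: lt_le_trans (truncnS_gt _) _.
  by rewrite -natrX ler_nat ltnW// ltn_expl.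
elim: k => [|k IH] x y xc yc xy.
  by apply: h; rewrite ?hc//; move: xy; rewrite expr0 mul1r.
pose m := 2^-1 *: (x + y).
have xm : x - m = 2^-1 *: (x - y).
  rewrite /m scalerDr scalerBr opprD addrA.
  by rewrite -{1}(scale1r x) -scalerBl (_ : 1 - 2^-1 = 2^-1 :> R)//; lra.
have my : m - y = 2^-1 *: (x - y).
  rewrite -[RHS]opprK -scalerN opprB -[m - y]opprK opprB; congr (- _).
  rewrite /m [x + y]addrC scalerDr scalerBr opprD addrA.
  by rewrite -{1}(scale1r y) -scalerBl (_ : 1 - 2^-1 = 2^-1 :> R)//; lra.
have mc : ipnorm dotv (m - c) <= r.
  have -> : m - c = 2^-1 *: (x - c) + 2^-1 *: (y - c).
    rewrite -scalerDr addrACA -opprD scalerBr -[c + c]/(c *+ 2) -(scaler_nat 2 c).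
    by rewrite scalerA mulVf// scale1r.
  by rewrite (le_trans (norm2D _ _))// !norm2Z ger0_norm ?invr_ge0//; lra.
have half : ipnorm dotv (2^-1 *: (x - y)) = 2^-1 * ipnorm dotv (x - y).
  by rewrite norm2Z ger0_norm ?invr_ge0.
rewrite exprS in xy.
have := IH x m xc mc; rewrite xm half => /(_ _)/wrap[|h1]; first by lra.
have := IH m y mc yc; rewrite my half => /(_ _)/wrap[|h2]; first by lra.
move: (gradient dotv F x) (gradient dotv F y) (gradient dotv F m) h1 h2.
move=> p q p' h1 h2; rewrite -(subrKA p' p (- q)).
apply: le_trans (norm2D _ _) _.
apply: le_trans (lerD h1 h2) _.
by rewrite -mulrDr -mulrDl (_ : 2^-1 + 2^-1 = 1 :> R) ?mul1r//; lra.
Qed.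

End LocallyLipschitzGradient.

(** * Second differences of a convex envelope *)

Section ConvexEnvelope.
Context {R : realType} {n : nat}.
Implicit Types (u v w x y z : 'rV[R]_n) (r s : R).
Variable g : 'rV[R]_n -> R.
Hypothesis g_minorants : forall x, has_sup [set psi x | psi in
  [set psi : 'rV[R]_n -> R | convex psi /\ forall y, psi y <= g y]].
Let F := convex_envelope g.

Lemma convex_envelope_le x : F x <= g x.
Proof.
apply: ge_sup; first by have [] := g_minorants x.
by move=> _ [psi [_ psig] <-].
Qed.

Lemma le_convex_envelope psi x : convex psi -> (forall y, psi y <= g y) ->
  psi x <= F x.
Proof.
by move=> cpsi psig; apply: ub_le_sup; [have [] := g_minorants x|exists psi].
Qed.

Lemma convex_convex_envelope : convex F.
Proof.
apply/convexP => x y l /andP[l0 l1].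
apply: ge_sup; first by have [] := g_minorants (l *: x + (1 - l) *: y).
move=> _ [psi [cpsi psig] <-].
apply: (@le_trans _ _ (l * psi x + (1 - l) * psi y)).
  by apply: (convexP psi).1 => //; rewrite l0.
by rewrite lerD// ler_wpM2l ?subr_ge0 ?le_convex_envelope.
Qed.

(* A convex set containing the graph of [g] comes arbitrarily close to the
   graph of the envelope; this replaces the description of the envelope by
   convex combinations of values of [g]. *)
Lemma convex_envelope_adherent (S : 'rV[R]_n -> R -> Prop) :
  (forall x, S x (g x)) ->
  (forall x y r s l, 0 <= l <= 1 -> S x r -> S y s ->
     S (l *: x + (1 - l) *: y) (l * r + (1 - l) * s)) ->
  (forall x s, S x s -> F x <= s) ->
  forall x e, 0 < e -> exists2 s, S x s & s < F x + e.
Proof.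
(* [K] is the lower boundary of [S]: it is convex because [S] is, and below [g] because [S] contains
   the graph of [g]; hence [K <= F]. *)
move=> Sg cS FS x e e0; pose K x := inf [set s | S x s].
have infK y : has_inf [set s | S y s].
  by split; [exists (g y); exact: Sg|exists (F y) => s; exact: FS].
have Kle y s : S y s -> K y <= s by move=> Ss; apply: ge_inf; [have [] := infK y|].
have cK : convex K.
  apply/convexP => y z l l01; apply/ler_addgt0Pr => d d0.
  have [s Ss sK] := inf_adherent d0 (infK y).
  have [r Sr rK] := inf_adherent d0 (infK z).
  apply: le_trans (Kle _ _ (cS _ _ _ _ _ l01 Ss Sr)) _.
  move: l01 => /andP[l0 l1]; rewrite -subr_ge0 in l1.
  have := ler_wpM2l l0 (ltW sK); have := ler_wpM2l l1 (ltW rK).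
  by rewrite -/(K y) -/(K z); lra.
have [s Ss sK] := inf_adherent e0 (infK x).
exists s => //; apply: lt_le_trans sK _; rewrite lerD2r.
exact: (le_convex_envelope x cK (fun y => Kle y _ (Sg y))).
Qed.

Variable N : 'rV[R]_n -> R.
Hypothesis N0 : forall x, 0 <= N x.
Hypothesis NZ : forall (a : R) x, N (a *: x) = `|a| * N x.

(* Only the part of a convex combination lying in a large ball is translated:
   coercivity forces that part to carry at least half of the mass [l]. *)
Lemma convex_envelope_semiconcave e (c C : R) : 0 < c ->
  (forall x, dotv e x + c * N x - C <= g x) ->
  (forall r, exists B, forall x, N x <= r -> g x <= dotv e x + B) ->
  (forall r, exists2 M : R, 0 <= M & forall x w, N x <= r -> N w <= 1 ->
     g (x + w) + g (x - w) <= 2 * g x + M * N w ^+ 2) ->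
  forall r, exists2 M : R, 0 <= M & forall x w, N x <= r -> N w <= 2^-1 ->
    F (x + w) + F (x - w) <= 2 * F x + M * N w ^+ 2.
Proof.
move=> c0 gc gB gM r; have [B hB] := gB r.
(* Beyond the radius [r'] the coercive bound exceeds [dotv e x - C] by at least [2 * Z], whereas a
   height below [F x + 1] with [N x <= r] is at most [Z] above it. So at most half of the mass can
   be far away. *)
pose Z := `|B| + 1 + `|C|; pose r' := 2 * Z / c.
have Z0 : 0 < Z by rewrite /Z; have := normr_ge0 B; have := normr_ge0 C; lra.
have cr' : c * r' = 2 * Z by rewrite /r' mulrC divfK// gt_eqF.
have [M M0 hM] := gM r'.
(* [S] records what a convex combination of graph points retains: [l] is the mass taken where [N] is
   at most [r'], only this mass is translated by [w], and the remaining mass [1 - l] costs at least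
   [2 * Z] per unit. Graph points have [l = 1] or [l = 0]. *)
pose S x s := exists l : R, [/\ 0 <= l <= 1,
  forall w, N w <= 1 -> F (x + l *: w) + F (x - l *: w) <= 2 * s + l * M * N w ^+ 2
  & dotv e x - C + (1 - l) * (2 * Z) <= s].
have Sg x : S x (g x).
  have gcx := gc x.
  have [xr|xr] := leP (N x) r'.
    exists 1; split; first by rewrite ler01 lexx.
      move=> w w1; rewrite scale1r mul1r; apply: le_trans (hM x w xr w1).
      by rewrite lerD// convex_envelope_le.
    have : 0 <= c * N x by rewrite mulr_ge0 ?N0 ?(ltW c0).
    by lra.
  exists 0; split; first by rewrite ler01 lexx.
    move=> w _; rewrite scale0r subr0 addr0 !mul0r addr0.
    by have := convex_envelope_le x; lra.
  have : c * r' <= c * N x by rewrite ler_pM2l// ltW.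
  by rewrite cr'; lra.
have cS x y s q l : 0 <= l <= 1 -> S x s -> S y q ->
    S (l *: x + (1 - l) *: y) (l * s + (1 - l) * q).
  move=> l01; have /andP[l0 l1] := l01; rewrite -subr_ge0 in l1.
  move=> [l1' [/andP[a0 a1] h1 k1]] [l2 [/andP[b0 b1] h2 k2]].
  exists (l * l1' + (1 - l) * l2); split.
  - by apply/andP; split; nra.
  - move=> w w1; have {}h1 := ler_wpM2l l0 (h1 w w1).
    have {}h2 := ler_wpM2l l1 (h2 w w1).
    have hF u v : F (l *: u + (1 - l) *: v) <= l * F u + (1 - l) * F v.
      by apply: (convexP F).1 => //; exact: convex_convex_envelope.
    have := hF (x + l1' *: w) (y + l2 *: w); have := hF (x - l1' *: w) (y - l2 *: w).
    have eqp : l *: (x + l1' *: w) + (1 - l) *: (y + l2 *: w) =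
        l *: x + (1 - l) *: y + (l * l1' + (1 - l) * l2) *: w.
      by rewrite !scalerDr addrACA !scalerA -scalerDl.
    have eqm : l *: (x - l1' *: w) + (1 - l) *: (y - l2 *: w) =
        l *: x + (1 - l) *: y - (l * l1' + (1 - l) * l2) *: w.
      by rewrite !scalerBr addrACA !scalerA -opprD -scalerDl.
    by rewrite eqp eqm; lra.
  - have {}k1 := ler_wpM2l l0 k1; have {}k2 := ler_wpM2l l1 k2.
    by rewrite dotvDr !dotvZr; lra.
have FS x s : S x s -> F x <= s.
  move=> [l [_ /(_ 0) + _]]; rewrite scaler0 subr0 addr0 -(scale0r 0) NZ normr0 mul0r.
  by move=> /(_ ler01); rewrite expr0n /= mulr0; lra.
exists (2 * M); first by rewrite mulr_ge0.
move=> x v xr v2; apply/ler_addgt0Pr => d d0.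
pose e' := Num.min 1 (d / 2).
have e'0 : 0 < e' by rewrite lt_min ltr01 divr_gt0.
have e'1 : e' <= 1 by rewrite ge_min lexx.
have e'd : e' <= d / 2 by rewrite ge_min lexx orbT.
have [s [l [/andP[l0 l1] hs ks]] sF] := convex_envelope_adherent Sg cS FS x e'0.
have l2 : 2^-1 <= l.
  have := hB x xr; have := convex_envelope_le x => h1 h2.
  have : (1 - l) * (2 * Z) <= Z.
    by rewrite /Z; have := ler_norm B; have := ler_norm C; rewrite /Z in ks; lra.
  by nra.
have lp : 0 < l by lra.
(* Translating the mass [l] by [l^-1 *: v] moves the barycentre by exactly [v]; [l >= 1/2] keeps
   this translation in the unit ball and costs a factor [l^-1 <= 2]. *)
have := hs (l^-1 *: v); rewrite NZ ger0_norm ?invr_ge0// scalerA divff ?gt_eqF// scale1r.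
move=> /(_ _)/wrap[|h].
  by rewrite ler_pdivrMl// mulr1; lra.
have : l * M * (l^-1 * N v) ^+ 2 <= 2 * M * N v ^+ 2.
  have -> : l * M * (l^-1 * N v) ^+ 2 = l^-1 * (M * N v ^+ 2).
    by field; rewrite gt_eqF.
  rewrite -mulrA; apply: ler_wpM2r; first by rewrite mulr_ge0 ?sqr_ge0.
  by rewrite -[leRHS]invrK lef_pV2// posrE ?invr_gt0.
by lra.
Qed.

End ConvexEnvelope.

(** * Mean value theorem along lines and Taylor bounds from a Lipschitz gradient *)

Section LineDerivative.
Context {R : realType} {V : normedModType R}.
Variables (f : V -> R^o).
Hypothesis df : forall x, differentiable f x.

Lemma is_derive_line (x w : V) (s : R) :
  is_derive s 1 (fun s => f (x + s *: w)) ('d f (x + s *: w) w).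
Proof.
have E : (fun h : R => h^-1 *: (((fun s => f (x + s *: w)) \o shift s) (h *: 1) -
      f (x + s *: w))) =
    (fun h => h^-1 *: ((f \o shift (x + s *: w)) (h *: w) - f (x + s *: w))).
  apply/funext => h /=; rewrite [h *: 1]mulr1.
  by rewrite scalerDl addrCA.
apply: DeriveDef; first by rewrite /derivable E; exact: diff_derivable.
by rewrite /derive E -deriveE.
Qed.

Lemma mean_value_line (x w : V) :
  exists2 s : R, 0 < s < 1 & f (x + w) - f x = 'd f (x + s *: w) w.
Proof.
have dl (s : R) := is_derive_line x w s.
have [|s s01] := @MVT R _ _ 0 1 ltr01 (fun s _ => dl s).
  apply: derivable_within_continuous => s _; exact: ex_derive.
by rewrite scale1r scale0r addr0 subr0 mulr1 => ->; exists s.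
Qed.

(** The mean value theorem is applied to the sum of the two restrictions, so that the same [s]
    occurs at both points and the gradients are compared at distance [2 * s * |w|]. *)
Lemma mean_value_line_sym (x w : V) : exists2 s : R, 0 < s < 1 &
  f (x + w) + f (x - w) - 2 * f x =
  'd f (x + s *: w) w - 'd f (x - s *: w) w.
Proof.
have dl (s : R) : is_derive s 1
    ((fun s => f (x + s *: w)) + (fun s => f (x + s *: (- w))))
    ('d f (x + s *: w) w + 'd f (x + s *: (- w)) (- w)).
  by apply: is_deriveD; exact: is_derive_line.
have [|s s01] := @MVT R _ _ 0 1 ltr01 (fun s _ => dl s).
  apply: derivable_within_continuous => s _; exact: ex_derive.
rewrite !fctE !scale1r !scale0r !addr0 subr0 mulr1 => E.
exists s => //; move: E; rewrite (linearN ('d f (x + s *: - w))) scalerN => <-; ring.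
Qed.

End LineDerivative.

Section SubspaceInnerProduct.
Context {R : realType} {n : nat} (X : {vspace 'rV[R]_n}).
Implicit Types (u v w : subvs_of X).
Local Notation norm := (ipnorm (subdot X)).

Lemma subdotBl u v w : subdot X (u - v) w = subdot X u w - subdot X v w.
Proof. by rewrite /subdot linearB dotvBl. Qed.

Lemma subnormD u v : norm (u + v) <= norm u + norm v.
Proof. by rewrite !subnormE linearD norm2D. Qed.

Lemma subnormZ (s : R) u : norm (s *: u) = `|s| * norm u.
Proof. by rewrite !subnormE linearZ norm2Z. Qed.

Lemma subnorm_ge0 u : 0 <= norm u. Proof. exact: norm2_ge0. Qed.

Lemma subnorm_eq0 u : norm u = 0 -> u = 0.
Proof. by move=> /norm2_eq0 u0; exact: val_inj. Qed.

Lemma subdot_le u v : subdot X u v <= norm u * norm v.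
Proof. exact: cauchy_schwarz. Qed.

End SubspaceInnerProduct.

Section LipschitzGradient.
Context {R : realType} {V : normedModType R}.
Implicit Types (u v w p : V).
Variables (ip : V -> V -> R) (norm : V -> R) (phi : V -> R) (nabla : V -> V).
Hypothesis ipBl : forall u v w, ip (u - v) w = ip u w - ip v w.
Hypothesis ip_le : forall u v, ip u v <= norm u * norm v.
Hypothesis normD : forall u v, norm (u + v) <= norm u + norm v.
Hypothesis normZ : forall (s : R) u, norm (s *: u) = `|s| * norm u.
Hypothesis norm_ge0 : forall u, 0 <= norm u.
Hypothesis dphi : forall u, differentiable (phi : _ -> R^o) u.
Hypothesis nablaE : forall u h, 'd (phi : _ -> R^o) u h = ip (nabla u) h.
Variables (r L : R).
Hypothesis L0 : 0 <= L.
Hypothesis phiL : forall u v, norm u <= r -> norm v <= r ->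
  norm (nabla u - nabla v) <= L * norm (u - v).

Let dphiB u v w : norm u <= r -> norm v <= r ->
  ip (nabla u) w - ip (nabla v) w <= L * norm (u - v) * norm w.
Proof.
move=> ur vr; rewrite -ipBl.
by apply: le_trans (ip_le _ _) _; rewrite ler_wpM2r// phiL.
Qed.

Lemma second_difference_le u w : norm u + norm w <= r ->
  phi (u + w) + phi (u - w) <= 2 * phi u + 2 * L * norm w ^+ 2.
Proof.
move=> uwr; have [s /andP[s0 s1] E] := mean_value_line_sym dphi u w.
rewrite !nablaE in E; have w0 := norm_ge0 w.
have sw : norm (s *: w) <= norm w by rewrite normZ gtr0_norm// ler_piMl// ltW.
have h1 : norm (u + s *: w) <= r.
  by apply: le_trans uwr; rewrite (le_trans (normD _ _))// lerD2l.
have h2 : norm (u - s *: w) <= r.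
  rewrite -scaleNr; apply: le_trans uwr; rewrite (le_trans (normD _ _))//.
  by rewrite lerD2l normZ normrN -normZ.
have E2 : u + s *: w - (u - s *: w) = (s + s) *: w.
  by rewrite opprB addrC addrA subrK -scalerDl.
have := dphiB w h1 h2; rewrite -E E2 normZ ger0_norm; last by lra.
have : 0 <= (1 - s) * (L * norm w ^+ 2) by rewrite !mulr_ge0 ?sqr_ge0//; lra.
by rewrite expr2; lra.
Qed.

Lemma first_order_le p u : norm p <= r -> norm u <= r ->
  phi u <= phi p + ip (nabla p) (u - p) + L * norm (u - p) ^+ 2.
Proof.
move=> pr ur; have [s /andP[s0 s1] E] := mean_value_line dphi p (u - p).
rewrite nablaE (addrC p) subrK in E.
have h1 : norm (p + s *: (u - p)) <= r.
  have -> : p + s *: (u - p) = (1 - s) *: p + s *: u.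
    by rewrite scalerBr scalerBl scale1r addrA addrAC.
  apply: le_trans (normD _ _) _; rewrite !normZ !ger0_norm ?(ltW s0)//; last by lra.
  have := ler_wpM2l (ltW s0) ur; have : (1 - s) * norm p <= (1 - s) * r.
    by rewrite ler_wpM2l// subr_ge0 ltW.
  by lra.
have E2 : p + s *: (u - p) - p = s *: (u - p) by rewrite addrC addrA addNr add0r.
have := dphiB (u - p) h1 pr; rewrite -E E2.
rewrite normZ gtr0_norm//.
have : 0 <= (1 - s) * (L * norm (u - p) ^+ 2).
  by rewrite !mulr_ge0 ?sqr_ge0//; lra.
by rewrite expr2; lra.
Qed.

End LipschitzGradient.

(** * Coercivity from slopes whose differences span [X] *)

Lemma setspan_seq (K : fieldType) (V : vectType K) (B : set V) :
  exists2 s : seq V, (forall v, v \in s -> B v) & setspan B = span s.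
Proof.
(* Every vector of the span uses only finitely many elements of [B]; concatenating these lists over
   a basis gives a finite generating list. *)
suff H (b : seq V) : (forall v, v \in b -> v \in setspan B) ->
    exists2 s : seq V, (forall v, v \in s -> B v) & (span b <= span s)%VS.
  have [v|s sB bs] := H (vbasis (setspan B)); first exact: vbasis_mem.
  exists s => //; apply/eqP; rewrite eqEsubv; apply/andP; split.
    by rewrite -{1}(span_basis (vbasisP (setspan B))).
  apply/span_subvP => v vs; apply/mem_setspan; exists [:: v].
    by move=> w; rewrite inE => /eqP ->; exact: sB.
  by rewrite memv_span1.
elim: b => [_|v b IH vbB]; first by exists [::] => //; rewrite span_nil sub0v.
have [w wb|s sB bs] := IH; first by apply: vbB; rewrite inE wb orbT.
have /mem_setspan[s' s'B vs'] := vbB v (mem_head _ _).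
exists (s' ++ s) => [w|]; first by rewrite mem_cat => /orP[/s'B|/sB].
by rewrite span_cons span_cat addvS// -memvE.
Qed.

Section Coercivity.
Context {R : realType} {n : nat}.
Implicit Types (u v w x y z : 'rV[R]_n) (X : {vspace 'rV[R]_n}).

Lemma jet_span_mem (A : set 'rV[R]_n) (xi : 'rV[R]_n -> 'rV[R]_n) y z :
  A y -> A z -> xi y - xi z \in jet_span A xi.
Proof.
move=> Ay Az; apply/mem_setspan; exists [:: xi y - xi z]; last by rewrite memv_span1.
by move=> v; rewrite inE => /eqP ->; exists y => //; exists z.
Qed.

Variables (A : set 'rV[R]_n) (xi : 'rV[R]_n -> 'rV[R]_n) (g : 'rV[R]_n -> R).
Hypothesis gA : forall z, A z -> exists C, forall x, dotv (xi z) x - C <= g x.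
Variable z0 : 'rV[R]_n.
Hypothesis Az0 : A z0.
Local Notation X := (jet_span A xi).
Local Notation N x := (ipnorm (subdot X) (orth_proj X x)).

(* Averaging [e] with the slopes [xi y] and [xi z] produces an affine minorant
   that can be tilted in the direction [xi y - xi z]. *)
Let tilted_minorants (s : seq 'rV[R]_n) :
  (forall v, v \in s -> [set xi y - xi z | y in A & z in A] v) ->
  exists e (d C : R), [/\ 0 < d, e - xi z0 \in X,
    forall x, dotv e x - C <= g x
  & forall v, v \in s -> forall x, dotv e x + d * `|dotv v x| - C <= g x].
Proof.
elim: s => [_|v s IH vsA].
  have [C hC] := gA Az0; exists (xi z0), 1, C; split => //.
  by rewrite subrr mem0v.
have [v' v's|e [d [C [d0 eX he hs]]]] := IH; first by apply: vsA; rewrite inE v's orbT.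
have [y Ay [z Az vE]] := vsA v (mem_head _ _).
have [Cy hy] := gA Ay; have [Cz hz] := gA Az.
(* Half of the weight stays on [e], so the old tilts survive with factor 1/2. The other half goes to
   the larger of the minorants of slopes [xi y] and [xi z], which exceeds their mean by half of
   [|dotv v x|], up to constants: this is the new tilt of size 1/4. *)
pose e' := 2^-1 *: e + 4^-1 *: (xi y + xi z).
have e'E x : dotv e' x = 2^-1 * dotv e x + 4^-1 * (dotv (xi y) x + dotv (xi z) x).
  by rewrite dotvDl !dotvZl dotvDl.
pose d' := Num.min (d / 2) 4^-1.
have d1 : d' <= d / 2 by rewrite ge_min lexx.
have d2 : d' <= 4^-1 by rewrite ge_min lexx orbT.
have Cy0 := ler_norm Cy; have Cz0 := ler_norm Cz.
have Cy1 := normr_ge0 Cy; have Cz1 := normr_ge0 Cz.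
exists e', d', (2^-1 * C + 2^-1 * (`|Cy| + `|Cz|)); split.
- by rewrite lt_min divr_gt0//= invr_gt0.
- have -> : e' - xi z0 = 2^-1 *: (e - xi z0) +
      4^-1 *: ((xi y - xi z0) + (xi z - xi z0)).
    rewrite addrACA -opprD !scalerBr addrACA -opprD; congr (_ - _).
    rewrite -[xi z0 + xi z0]/(xi z0 *+ 2) -(scaler_nat 2 (xi z0)) scalerA -scalerDl.
    by rewrite -[LHS]scale1r; congr (_ *: _); lra.
  by apply: memvD; [exact: memvZ|apply/memvZ/memvD; exact: jet_span_mem].
- by move=> x; rewrite e'E; have := he x; have := hy x; have := hz x; lra.
- move=> v'; rewrite inE => /orP[/eqP ->|v's] x; rewrite e'E.
    have : d' * `|dotv v x| <= 4^-1 * `|dotv v x| by rewrite ler_wpM2r.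
    rewrite -vE dotvBl; have := he x; have := hy x; have := hz x.
    by case: (ger0P (dotv (xi y) x - dotv (xi z) x)) => _; lra.
  have : d' * `|dotv v' x| <= d / 2 * `|dotv v' x| by rewrite ler_wpM2r.
  by have := hs v' v's x; have := hy x; have := hz x; lra.
Qed.

(** Expand [N x ^+ 2], the product of [P x] with [x], in the generators. The coordinates of [P x]
    are linear in it, hence bounded by multiples of [N x], and one factor [N x] cancels. *)
Let projnorm_le_sum (s : seq 'rV[R]_n) : X = span s ->
  exists c : 'I_(size s) -> R, (forall i, 0 <= c i) /\
    forall x, N x <= \sum_i c i * `|dotv s`_i x|.
Proof.
move=> Xs; pose l i := fun u => coord (in_tuple s) i (vsval (orth_proj X u)).
pose gl i : 'rV[R]_n := \row_k l i (delta_mx 0 k).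
have lE i u : l i u = dotv (gl i) (vsval (orth_proj X u)).
  have -> : l i u = l i (vsval (orth_proj X u)) by rewrite /l orth_proj_id.
  apply: linear_formE => [v w|b v]; rewrite /l.
    by rewrite orth_projD !linearD.
  by rewrite orth_projZ !linearZ.
exists (fun i => ipnorm dotv (gl i)); split=> [i|x]; first exact: norm2_ge0.
have [->|Nx0] := eqVneq (N x) 0.
  by apply: sumr_ge0 => i _; rewrite mulr_ge0// norm2_ge0.
have Nx : 0 < N x by rewrite lt_neqAle eq_sym Nx0 projnorm_ge0.
rewrite -(ler_pM2l Nx) -expr2 subnormE sqr_norm2 dotv_orth_proj ?subvsP//.
have PX : vsval (orth_proj X x) \in span (in_tuple s) by rewrite /= -Xs subvsP.
rewrite {1}(coord_span PX) dotv_suml mulr_sumr; apply: ler_sum => i _.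
rewrite dotvZl -/(l i x) (le_trans (ler_norm _))// normrM mulrA ler_wpM2r//.
by rewrite lE (le_trans (cauchy_schwarz_norm _ _))// mulrC.
Qed.

Lemma affine_minorants_coercive : exists e (c C : R),
  [/\ 0 < c, e - xi z0 \in X & forall x, dotv e x + c * N x - C <= g x].
Proof.
have [s sA Xs] := setspan_seq [set xi y - xi z | y in A & z in A].
have [e [d [C [d0 eX he hs]]]] := tilted_minorants sA.
have [c [c0 hc]] := projnorm_le_sum Xs.
(* Adding the tilted bounds with weights [c i] bounds [d * N x] by [K] times the gap between [g] and
   the affine minorant. Dividing by [K + 1] covers the case [K = 0]. *)
pose K := \sum_i c i; have K0 : 0 <= K by exact: sumr_ge0.
have K1 : 0 < K + 1 by rewrite ltr_wpDl.
exists e, (d / (K + 1)), C; split=> // [|x]; first by rewrite divr_gt0.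
have gx : 0 <= g x - dotv e x + C by have := he x; lra.
suff : d / (K + 1) * N x <= g x - dotv e x + C by lra.
rewrite mulrAC ler_pdivrMr//.
apply: (@le_trans _ _ (\sum_i c i * (g x - dotv e x + C))); last first.
  by rewrite -mulr_suml -/K mulrC ler_wpM2l// lerDl.
apply: (@le_trans _ _ (d * \sum_i c i * `|dotv s`_i x|)).
  by rewrite ler_wpM2l// ltW.
rewrite mulr_sumr ler_sum// => i _; rewrite mulrCA ler_wpM2l//.
by have := hs s`_i (mem_nth _ (ltn_ord i)) x; lra.
Qed.

End Coercivity.

(** * Sufficiency: the formula defines an extension *)

Lemma second_difference_arith (R : realFieldType)
    (a L d e gp gm gx ap am ax fp fm fx np nm nx nw : R) : e <= d / 2 ->
  gp <= ap + fp + a * np -> gm <= am + fm + a * nm ->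
  ax + fx + a * nx < gx + e -> ap + am = 2 * ax -> np + nm = 2 * nx + 2 * nw ->
  fp + fm <= 2 * fx + 2 * L * nw ->
  gp + gm <= 2 * gx + (2 * L + 2 * a) * nw + d.
Proof.
move=> ed h1 h2 h3 h4 h5 h6.
have : a * (np + nm) = 2 * a * nx + 2 * a * nw by rewrite h5; ring.
by lra.
Qed.

Section WhitneyExtension.
Context {R : realType} {n : nat}.
Implicit Types (u v w x y z : 'rV[R]_n).
Variables (A : set 'rV[R]_n) (t : 'rV[R]_n -> R) (xi : 'rV[R]_n -> 'rV[R]_n).
Variables (X : {vspace 'rV[R]_n}) (phi : 'rV[R]_n -> subvs_of X -> R) (a : R).
Hypotheses (A0 : A !=set0) (wA : whitney_condition A t xi phi) (a0 : 0 < a).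
Local Notation P := (orth_proj X).
Local Notation norm := (ipnorm (subdot X)).
Local Notation nabla := (gradient (subdot X)).
Local Notation N x := (norm (P x)).

Let aff z x := t z + dotv (xi z) (x - z).
Let U y x := aff y x + phi y (P x) + a * N (x - y) ^+ 2.
Let g x := inf (upper_values A t xi phi a x).
Let F := extension_formula A t xi phi a.

Let dphi y : A y -> forall u : subvs_of X, differentiable (phi y : _ -> R^o) u.
Proof. by have [h _ _ _ _ Ay] := wA; have [_ []] := h y Ay. Qed.

Let phiP y : A y -> phi y (P y) = 0 /\ nabla (phi y) (P y) = 0.
Proof. by have [_ _ h _ _] := wA; exact: h. Qed.

Let phi_lip r : exists2 L : R, 0 <= L & forall y, A y -> N y <= r ->
  forall u v : subvs_of X, norm u <= r -> norm v <= r ->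
  norm (nabla (phi y) u - nabla (phi y) v) <= L * norm (u - v).
Proof.
(* The condition concerns positive radii only, whence [|r| + 1]. *)
have [_ _ _ /(_ (`|r| + 1)) h _] := wA.
have [L hL] : exists L : R,
    (ereal_sup (EFin @` lipschitz_quotients A phi (`|r| + 1)) <= L%:E)%E.
  have := h (ltr_wpDl (normr_ge0 r) ltr01); case: (ereal_sup _) => [l _|//|_].
    by exists l.
  (* A supremum equal to [-oo]: there are no quotients at all. *)
  by exists 0; rewrite leNye.
exists `|L| => // y Ay yr u v ur vr.
have r1 : r <= `|r| + 1 by have := ler_norm r; lra.
have [->|uv] := eqVneq u v; first by rewrite !subrr !subnormE linear0 norm2_0 mulr0.
have uv0 : 0 < norm (u - v).
  rewrite lt_neqAle norm2_ge0 andbT eq_sym; apply: contra_neq uv => uv0.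
  apply/eqP; rewrite -subr_eq0; apply/eqP/val_inj => /=.
  by apply: norm2_eq0.
rewrite -ler_pdivrMr//; apply: le_trans (ler_norm L); rewrite -lee_fin.
apply: le_trans hL; apply: ereal_sup_ubound.
exists (norm (nabla (phi y) u - nabla (phi y) v) / norm (u - v)) => //.
by exists y, u, v; split; rewrite ?(le_trans _ r1).
Qed.

(** The constant [L] is uniform over the indices [y] with [N y <= r]. The first bound is the Taylor
    estimate at [P y], where [phi y] and its gradient vanish. *)
Let phi_bounds r : exists2 L : R, 0 <= L & forall y, A y -> N y <= r ->
  (forall u : subvs_of X, norm u <= r -> phi y u <= L * norm (u - P y) ^+ 2) /\
  (forall u w : subvs_of X, norm u + norm w <= r ->
     phi y (u + w) + phi y (u - w) <= 2 * phi y u + 2 * L * norm w ^+ 2).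
Proof.
have [L L0 hL] := phi_lip r; exists L => // y Ay yr; have {}hL := hL y Ay yr.
have [phi0 dphi0] := phiP Ay.
have nablaE := @gradient_subdotP R n X (phi y).
move: (nabla (phi y)) hL nablaE dphi0 => G hL GE G0.
split=> [u ur|u w uw].
  have := @first_order_le _ _ _ _ _ G (@subdotBl R n X) (@subdot_le R n X)
    (@subnormD R n X) (@subnormZ R n X) (@subnorm_ge0 R n X) (dphi Ay) GE r L L0 hL
    (P y) u yr ur.
  by rewrite phi0 G0 /subdot linear0 dotv0l !add0r.
exact: (@second_difference_le _ _ _ _ _ G (@subdotBl R n X) (@subdot_le R n X)
    (@subnormD R n X) (@subnormZ R n X) (@subnorm_ge0 R n X) (dphi Ay) GE r L L0 hL).
Qed.

Let aff_le_U z y x : A z -> A y -> aff z x + a * N (x - y) ^+ 2 <= U y x.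
Proof.
by move=> Az Ay; have [_ _ _ _ /(_ z y Az Ay x)] := wA; rewrite /U /aff; lra.
Qed.

Let has_inf_U x := has_inf_upper_values A0 wA a0 x.

Let g_le y x : A y -> g x <= U y x.
Proof. by move=> Ay; apply: (ge_inf (has_inf_U x).2); exists y. Qed.

Let le_g z x : A z -> aff z x <= g x.
Proof.
move=> Az; apply: lb_le_inf; first by have [] := has_inf_U x.
move=> _ [y Ay <-]; apply: le_trans (aff_le_U x Az Ay).
by rewrite lerDl mulr_ge0 ?sqr_ge0 ?(ltW a0).
Qed.

Let U_adherent x e : 0 < e -> exists2 y, A y & U y x < g x + e.
Proof.
by move=> e0; have [_ [y Ay <-] h] := inf_adherent e0 (has_inf_U x); exists y.
Qed.

Let projnormB x y : N (x - y) <= N x + N y.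
Proof. by rewrite (le_trans (projnormD _ _ _))// -scaleN1r projnormZ normrN1 mul1r. Qed.

Let U_bounded z : A z -> forall r, exists2 B, 0 <= B &
  forall x, N x <= r -> U z x <= aff z x + B.
Proof.
move=> Az r; pose r' := `|r| + N z; have [L L0 hL] := phi_bounds r'.
have Nz : 0 <= N z by exact: projnorm_ge0.
have r0 := normr_ge0 r; have rr := ler_norm r.
exists ((L + a) * r' ^+ 2); first by rewrite mulr_ge0 ?sqr_ge0 ?addr_ge0 ?(ltW a0).
move=> x xr; rewrite /U -addrA lerD2l.
have zr' : N z <= r' by rewrite lerDr.
have xr' : N x <= r' by rewrite /r'; lra.
have xz : N (x - z) <= r' by have := projnormB x z; rewrite /r'; lra.
have [/(_ (P x) xr') + _] := hL z Az zr'; rewrite -orth_projB.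
have sq : N (x - z) ^+ 2 <= r' ^+ 2.
  by rewrite ler_sqr ?nnegrE ?norm2_ge0//; apply: le_trans xz; exact: norm2_ge0.
have := ler_wpM2l L0 sq; have := ler_wpM2l (ltW a0) sq; lra.
Qed.

Let g_semiconcave r : exists2 M : R, 0 <= M & forall x w, N x <= r -> N w <= 1 ->
  g (x + w) + g (x - w) <= 2 * g x + M * N w ^+ 2.
Proof.
have [z Az] := A0; have [B B0 hB] := U_bounded Az r.
(* An index within 1 of the infimum satisfies [a * N (x - y) ^+ 2 <= B + 1], and [s <= 1 + s ^+ 2]
   turns this into [N (x - y) <= q]. The radius [r'] then accommodates [y] and [x] moved by [w] or
   [- w]. *)
pose q := 1 + (B + 1) / a; pose r' := `|r| + q + 1.
have q1 : 0 <= q by rewrite addr_ge0 ?divr_ge0 ?addr_ge0 ?(ltW a0).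
have [L L0 hL] := phi_bounds r'.
exists (2 * L + 2 * a); first by rewrite addr_ge0 ?mulr_ge0 ?(ltW a0).
move=> x w xr w1; apply/ler_addgt0Pr => d d0.
pose e := Num.min 1 (d / 2).
have e0 : 0 < e by rewrite lt_min ltr01 divr_gt0.
have e1 : e <= 1 by rewrite ge_min lexx.
have ed : e <= d / 2 by rewrite ge_min lexx orbT.
(* One nearly optimal index at [x] serves at all three points: [U y] bounds [g] from above at
   [x + w] and [x - w], and the total loss [2 * e] is at most [d]. *)
have [y Ay Uy] := U_adherent x e0.
have xy : N (x - y) <= q.
  have h : a * N (x - y) ^+ 2 <= B + 1.
    rewrite -(lerD2l (aff z x)) addrA.
    apply: le_trans (aff_le_U x Az Ay) _; apply: le_trans (ltW Uy) _.
    by apply: lerD e1; exact: le_trans (g_le x Az) (hB x xr).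
  rewrite mulrC -ler_pdivlMr// in h; apply: le_trans (_ : 1 + N (x - y) ^+ 2 <= _).
    by have := sqr_ge0 (N (x - y) - 1); rewrite expr2; have := sqr_ge0 (N (x - y)); lra.
  by rewrite lerD2l.
have rr := ler_norm r; have r0 := normr_ge0 r.
have yr : N y <= r'.
  by have := projnormB x (x - y); rewrite opprB addrC subrK /r'; lra.
have xwr : N x + N w <= r' by rewrite /r'; lra.
have [_ /(_ (P x) (P w) xwr)] := hL y Ay yr; rewrite -orth_projD -orth_projB => hphi.
(* Parallelogram identity: the quadratic term contributes exactly [2 * a * N w ^+ 2]. *)
have hN : N (x + w - y) ^+ 2 + N (x - w - y) ^+ 2 = 2 * N (x - y) ^+ 2 + 2 * N w ^+ 2.
  rewrite (addrAC x w) (addrAC x (- w)) (orth_projD X (x - y)) (orth_projB X (x - y)).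
  rewrite !subnormE !sqr_norm2.
  have -> : vsval (P (x - y) + P w) = vsval (P (x - y)) + vsval (P w) by rewrite linearD.
  have -> : vsval (P (x - y) - P w) = vsval (P (x - y)) - vsval (P w) by rewrite linearB.
  rewrite !dotvDl !dotvDr !dotvNl !dotvNr; lra.
have haff : aff y (x + w) + aff y (x - w) = 2 * aff y x.
  rewrite /aff (addrAC x w) (addrAC x (- w)) !(dotvDr _ w) !(dotvDr _ (- w)).
  by rewrite dotvNr; lra.
exact: second_difference_arith ed (g_le (x + w) Ay) (g_le (x - w) Ay) Uy haff hN hphi.
Qed.

Let minorants := has_sup_convex_envelope A0 wA a0.

Let F_le_g x : F x <= g x. Proof. exact: (convex_envelope_le minorants). Qed.

Let aff_le_F z x : A z -> aff z x <= F x.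
Proof.
move=> Az; apply: (le_convex_envelope minorants x (psi := aff z)); last first.
  by move=> y; exact: le_g.
apply/convexP => y y' l _; rewrite /aff !dotvBr dotvDr !dotvZr.
by rewrite le_eqVlt; apply/orP; left; apply/eqP; ring.
Qed.

Let cF : convex F. Proof. exact: (convex_convex_envelope minorants). Qed.

Let F_semiconcave r : exists2 M : R, 0 <= M & forall x w, N x <= r ->
  N w <= 2^-1 -> F (x + w) + F (x - w) <= 2 * F x + M * N w ^+ 2.
Proof.
have [z Az] := A0; have [_ Xs _ _ _] := wA.
have minA y : A y -> exists C : R, forall x, dotv (xi y) x - C <= g x.
  move=> Ay; exists (dotv (xi y) y - t y) => x.
  by have := le_g x Ay; rewrite /aff dotvBr; lra.
have [e [c [C [c0]]]] := affine_minorants_coercive minA Az; rewrite Xs => eX hc.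
apply: (convex_envelope_semiconcave minorants _ _ c0 hc _ g_semiconcave).
- by move=> x; exact: projnorm_ge0.
- by move=> b x; exact: projnormZ.
move=> s; have [B B0 hB] := U_bounded Az s.
(* The upper bound on [g] has slope [xi z] but is required with slope [e]; as [e - xi z] lies in
   [X], the two differ by a bounded amount where [N x <= s]. *)
exists (t z - dotv (xi z) z + B + ipnorm dotv (e - xi z) * `|s|) => x xs.
apply: le_trans (g_le x Az) _; apply: le_trans (hB x xs) _.
have : `|dotv (e - xi z) x| <= ipnorm dotv (e - xi z) * `|s|.
  rewrite -(dotv_orth_proj x eX) (le_trans (cauchy_schwarz_norm _ _))//.
  by rewrite ler_wpM2l ?norm2_ge0// (le_trans xs)// ler_norm.
by rewrite ler_norml dotvBl /aff dotvBr; lra.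
Qed.

Let F_semiconcave2 r : exists2 M : R, 0 <= M & forall x v,
  ipnorm dotv x <= r -> ipnorm dotv v <= 2^-1 ->
  F (x + v) + F (x - v) <= 2 * F x + M * ipnorm dotv v ^+ 2.
Proof.
have [M M0 h] := F_semiconcave r; exists M => // x v xr v2.
have vN := projnorm_le X v; have xN := projnorm_le X x.
apply: le_trans (h x v (le_trans xN xr) (le_trans vN v2)) _.
by rewrite lerD2l ler_wpM2l// ler_sqr ?nnegrE ?norm2_ge0.
Qed.

Let F_touch y : A y -> F y = t y.
Proof.
move=> Ay; have affy : aff y y = t y by rewrite /aff subrr dotv0r addr0.
apply/eqP; rewrite eq_le -{2}affy aff_le_F// andbT.
apply: le_trans (F_le_g y) _; apply: le_trans (g_le y Ay) _.
have [phi0 _] := phiP Ay.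
have N00 : N (y - y) = 0 by rewrite subrr -(scale0r 0) projnormZ normr0 mul0r.
by rewrite /U affy phi0 N00 expr0n mulr0 !addr0.
Qed.

Let subgradient_at y : A y -> subdifferential F y (xi y).
Proof. by move=> Ay x; rewrite F_touch//; exact: aff_le_F. Qed.

(* [F] grows at most linearly, with slope [xi z], in the directions orthogonal
   to [X]. *)
Let subgradient_mem z x p : A z -> subdifferential F x p -> p - xi z \in X.
Proof.
move=> Az sp; set q := (p - xi z) - vsval (P (p - xi z)).
have Pq : P q = 0 by rewrite orth_projB orth_proj_id subrr.
(* [q] is the component of [p - xi z] orthogonal to [X]. Along it [U z] is affine with slope [xi z],
   so [s * dotv q q] is bounded above for all real [s], which forces [q = 0]. *)
have hq (s : R) : s * dotv (p - xi z) q <= U z x - F x.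
  have xq : x + s *: q - x = s *: q by rewrite addrC addrA addNr add0r.
  have := sp (x + s *: q); rewrite xq => h.
  have : F (x + s *: q) <= U z (x + s *: q) := le_trans (F_le_g _) (g_le _ Az).
  have -> : U z (x + s *: q) = U z x + s * dotv (xi z) q.
    have Psq y : P (y + s *: q) = P y by rewrite orth_projD orth_projZ Pq scaler0 addr0.
    rewrite /U /aff (addrAC x (s *: q)) !Psq (dotvDr (x - z)) dotvZr; ring.
  by rewrite dotvZr in h; rewrite dotvBl; lra.
have qq : dotv (p - xi z) q = dotv q q.
  apply/eqP; rewrite -subr_eq0 -dotvBl subKr dotvC.
  by rewrite /q orth_projP.
have q0 : q = 0.
  apply: dotv_eq0; apply/eqP; rewrite eq_le dotv_ge0 andbT leNgt; apply/negP => qp.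
  have := hq ((`|U z x - F x| + 1) / dotv q q); rewrite qq divfK ?gt_eqF//.
  by have := ler_norm (U z x - F x); lra.
by rewrite -[p - xi z](subrK (vsval (P (p - xi z)))) -/q q0 add0r subvsP.
Qed.

Lemma whitney_extension : C11_convex_extension A t xi X F.
Proof.
have [z Az] := A0; have [_ Xs _ _ _] := wA.
split=> //; first exact: semiconcave_C11loc.
  move=> y Ay; apply: (semiconcave_gradient_unique F_semiconcave2) => v.
  have yv : y + v - y = v by rewrite addrC addrA addNr add0r.
  by have := subgradient_at Ay (y + v); rewrite yv.
apply/eqP; rewrite eqEsubv; apply/andP; split; apply/subvP => v.
  move=> /mem_setspan[s sA]; apply: subvP; apply/span_subvP => w /sA.
  move=> [x [y [u [u' [su su' ->]]]]].
  have -> : u - u' = (u - xi z) - (u' - xi z) by rewrite opprB subrKA.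
  apply: memvB; first exact: subgradient_mem Az su.
  exact: subgradient_mem Az su'.
rewrite -{1}Xs => /mem_setspan[s sA vs]; apply/mem_setspan; exists s => // w /sA.
move=> [y Ay [z' Az' <-]]; exists y, z', (xi y), (xi z').
by split => //; exact: subgradient_at.
Qed.

End WhitneyExtension.

(** * Subgradients of convex functions of class [C^{1,1}_loc] *)

Section C11Convex.
Context {R : realType} {n : nat}.
Implicit Types (u v w x y z : 'rV[R]_n).
Variable F : 'rV[R]_n -> R.
Hypotheses (cF : convex F) (F11 : C11loc dotv F).
Local Notation norm := (ipnorm dotv).

Let lip r : exists2 L : R, 0 <= L & forall u v, norm u <= r -> norm v <= r ->
  norm (gradient dotv F u - gradient dotv F v) <= L * norm (u - v).
Proof.
have [_ /(_ 0 r)[L hL]] := F11; exists `|L| => // u v ur vr.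
apply: le_trans (hL u v _ _) _; rewrite ?subr0//.
by rewrite ler_wpM2r ?norm2_ge0 ?ler_norm.
Qed.

(** Converse of [semiconcave_C11loc]: it makes the results on bounded second differences available
    for any convex function of this class. *)
Let FM r : exists2 M : R, 0 <= M & forall x v,
  norm x <= r -> norm v <= 2^-1 ->
  F (x + v) + F (x - v) <= 2 * F x + M * norm v ^+ 2.
Proof.
have [L L0] := lip (r + 2^-1).
have dF : forall x, differentiable (F : _ -> R^o) x by have [] := F11.
have := @gradient_dotvP R n F; move: (gradient dotv F) => G GE hL.
exists (2 * L); first by rewrite mulr_ge0.
move=> x v xr v2.
apply: (second_difference_le dotvBl cauchy_schwarz norm2D norm2Z norm2_ge0 dF GE L0 hL).
exact: lerD.
Qed.

Lemma C11loc_subgradient x v : F x + dotv (gradient dotv F x) v <= F (x + v).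
Proof. by have [_] := semiconcave_gradient cF FM x; exact. Qed.

Lemma C11loc_subgradient_unique x p :
  (forall v, F x + dotv p v <= F (x + v)) -> gradient dotv F x = p.
Proof. exact: semiconcave_gradient_unique. Qed.

Lemma C11loc_quadratic x : exists2 M : R, 0 <= M & forall v, norm v <= 2^-1 ->
  `|F (x + v) - F x - dotv (gradient dotv F x) v| <= M * norm v ^+ 2.
Proof.
have [M M0 h] := FM (norm x); exists M => // v v2.
have := h x v (lexx _) v2.
have := C11loc_subgradient x v; have := C11loc_subgradient x (- v).
rewrite dotvNr; move: (dotv _ v) => d h1 h2 h3.
by rewrite ger0_norm; lra.
Qed.

Lemma C11loc_subdifferential x p :
  subdifferential F x p <-> p = gradient dotv F x.
Proof.
split=> [sp|-> y]; last first.
  by have := C11loc_subgradient x (y - x); rewrite [in X in _ <= X]addrC subrK.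
apply/esym/C11loc_subgradient_unique => v.
have xv : x + v - x = v by rewrite addrC addrA addNr add0r.
by have := sp (x + v); rewrite xv.
Qed.

Lemma mem_subdiff_span x y :
  gradient dotv F x - gradient dotv F y \in subdiff_span F.
Proof.
apply/mem_setspan; exists [:: gradient dotv F x - gradient dotv F y].
  move=> v; rewrite inE => /eqP ->; exists x, y, (gradient dotv F x), (gradient dotv F y).
  by split=> //; exact/C11loc_subdifferential.
by rewrite memv_span1.
Qed.

End C11Convex.

(** * Necessity, with [G] standing for the gradient of [F] *)

Section Necessity.
Context {R : realType} {n : nat}.
Implicit Types (u v w x y z : 'rV[R]_n).
Variables (X : {vspace 'rV[R]_n}) (F : 'rV[R]_n -> R) (G : 'rV[R]_n -> 'rV[R]_n).
Local Notation norm := (ipnorm dotv).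
Local Notation P := (orth_proj X).
Hypothesis G_sub : forall x v, F x + dotv (G x) v <= F (x + v).
Hypothesis G_unique : forall x p,
  (forall v, F x + dotv p v <= F (x + v)) -> G x = p.
Hypothesis G_quad : forall x, exists2 M : R, 0 <= M & forall v, norm v <= 2^-1 ->
  `|F (x + v) - F x - dotv (G x) v| <= M * norm v ^+ 2.
Hypothesis G_lip : forall c r, exists L : R, forall u v,
  norm (u - c) <= r -> norm (v - c) <= r -> norm (G u - G v) <= L * norm (u - v).
Hypothesis GX : forall x y, G x - G y \in X.

(** All gradients have the same product with a vector [q] orthogonal to [X], so the subgradient
    inequalities from [x] to [x + q] and back are equalities. *)
Let F_orth x y q : P q = 0 -> F (x + q) = F x + dotv (G y) q.
Proof.
move=> Pq; have Gq z : dotv (G z) q = dotv (G y) q.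
  apply/eqP; rewrite -subr_eq0 -dotvBl -(dotv_orth_proj _ (GX _ _)) Pq.
  by rewrite linear0 dotv0r.
have h1 := G_sub x q; have := G_sub (x + q) (- q).
by rewrite addrK dotvNr Gq; rewrite Gq in h1; lra.
Qed.

Let orth_P x : P (x - vsval (P x)) = 0.
Proof. by rewrite orth_projB orth_proj_id subrr. Qed.

Let F_proj x y : F x = F (vsval (P x)) + dotv (G y) (x - vsval (P x)).
Proof. by rewrite -F_orth ?orth_P// [vsval _ + _]addrC subrK. Qed.

(** From [y] to [P y] the function [F] is affine with slope [G y], so the affine function supporting
    [F] at [y] also supports it at [P y]. *)
Let G_proj y : G (vsval (P y)) = G y.
Proof.
apply: G_unique => v; have := G_sub y (vsval (P y) - y + v).
rewrite (F_proj y y) (_ : y + (vsval (P y) - y + v) = vsval (P y) + v); last first.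
  by rewrite addrA (addrC y) subrK.
by rewrite (dotvDr _ v) !dotvBr; lra.
Qed.

Let phi y (u : subvs_of X) :=
  F (vsval u) - F (vsval (P y)) - dotv (G y) (vsval u - vsval (P y)).

Let phi_gradient y (u : subvs_of X) : differentiable (phi y : _ -> R^o) u /\
  gradient (subdot X) (phi y) u = P (G (vsval u) - G y).
Proof.
have [M M0 hM] := G_quad (vsval u).
apply: (@gradient_subdot_quadratic R n X (phi y) u _ M) => v v2.
have -> : phi y (u + v) - phi y u - subdot X (P (G (vsval u) - G y)) v =
    F (vsval u + vsval v) - F (vsval u) - dotv (G (vsval u)) (vsval v); last exact: hM.
rewrite /subdot dotvC dotv_orth_proj ?subvsP// dotvC.
have uv : vsval (u + v) = vsval u + vsval v by rewrite linearD.
by rewrite /phi uv dotvBl !dotvBr dotvDr; ring.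
Qed.

(** The vector [G y] cancels in the difference, so one Lipschitz constant of [G] serves for every
    index [y]. *)
Let phi_lip y (u v : subvs_of X) :
  norm (vsval (P (G (vsval u) - G y) - P (G (vsval v) - G y))) <=
  norm (G (vsval u) - G (vsval v)).
Proof.
rewrite -orth_projB opprB addrA subrK.
exact: (projnorm_le X).
Qed.

Let subnormB (u v : subvs_of X) :
  ipnorm (subdot X) (u - v) = norm (vsval u - vsval v).
Proof. by rewrite subnormE linearB. Qed.

Lemma whitney_of_extension (A : set 'rV[R]_n) (t : 'rV[R]_n -> R)
    (xi : 'rV[R]_n -> 'rV[R]_n) :
  jet_span A xi = X -> (forall y, A y -> t y = F y /\ xi y = G y) ->
  exists phi : 'rV[R]_n -> subvs_of X -> R, whitney_condition A t xi phi.
Proof.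
move=> AX tF; exists phi; split=> //.
- move=> y Ay; split=> [u|].
    have := G_sub (vsval (P y)) (vsval u - vsval (P y)); rewrite G_proj.
    by rewrite [vsval (P y) + _]addrC subrK /phi; lra.
  split=> [u|c r]; first by have [] := phi_gradient y u.
  have [L hL] := G_lip (vsval c) r; exists L => u v uc vc.
  have [_ ->] := phi_gradient y u; have [_ ->] := phi_gradient y v.
  apply: le_trans (phi_lip y u v) _.
  by rewrite subnormB in uc; rewrite subnormB in vc; rewrite subnormB; exact: hL.
- move=> y Ay; split; first by rewrite /phi !subrr dotv0r subr0.
  have [_ ->] := phi_gradient y (P y).
  by rewrite G_proj subrr -(scale0r 0) orth_projZ scale0r.
- move=> r r0; have [L hL] := G_lip 0 r.
  apply: (@le_lt_trans _ _ L%:E); last exact: ltry.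
  apply: ub_ereal_sup => _ [_ [y [u [v [_ _ ur vr [uv ->]]]]] <-].
  rewrite lee_fin.
  have [_ ->] := phi_gradient y u; have [_ ->] := phi_gradient y v.
  have uv0 : 0 < ipnorm (subdot X) (u - v).
    rewrite lt_neqAle subnorm_ge0 andbT eq_sym; apply: contra_neq uv.
    by move=> /subnorm_eq0/eqP; rewrite subr_eq0 => /eqP.
  rewrite ler_pdivrMr//; apply: le_trans (phi_lip y u v) _.
  by rewrite subnormB; apply: hL; rewrite subr0.
- move=> z y Az Ay x; have [-> ->] := tF _ Az; have [-> ->] := tF _ Ay.
  (* The right-hand side equals [F x] exactly, so only the tangent inequality at [z] is needed. *)
  have := G_sub z (x - z); rewrite [z + _]addrC subrK => /le_trans; apply.
  rewrite (F_proj x y) (F_proj y y) /phi !dotvBr.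
  by rewrite le_eqVlt; apply/orP; left; apply/eqP; ring.
Qed.

(* Adjoining a point whose gradient leaves the current span raises the dimension
   by exactly one; such a point is never in [E]. *)
Lemma new_points (e : 'rV[R]_n) (Y : {vspace 'rV[R]_n}) (m : nat) W :
  (forall W' : {vspace 'rV[R]_n}, (forall x y, G x - G y \in W') -> (X <= W')%VS) ->
  (Y <= W)%VS -> (W <= X)%VS -> \dim X = (m + \dim W)%N ->
  exists s : seq 'rV[R]_n, [/\ size s = m, forall p, p \in s -> G p - G e \notin Y
    & (X <= W + span [seq G p - G e | p <- s])%VS].
Proof.
move=> Xmin; elim: m W => [|m IH] W YW WX dX.
  exists [::]; split => //; rewrite span_nil addv0.
  by have /eqP -> : W == X by rewrite eqEdim WX dX add0n leqnn.
(* Otherwise every difference of gradients lies in [W], and minimality of [X] contradicts the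
   dimension count. *)
have [p pW] : exists p, G p - G e \notin W.
  apply: contrapT => nex; suff : (X <= W)%VS.
    by move=> /dimvS; rewrite dX addSn ltnNge leq_addl.
  apply: Xmin => x y; rewrite -(subrKA (G e)) -(opprB (G y)).
  by apply: memvB; apply: contrapT => /negP h; apply: nex; [exists x|exists y].
pose W' := (W + <[G p - G e]>)%VS.
have dW' : \dim W' = (\dim W).+1.
  rewrite dimv_disjoint_sum.
    rewrite dim_vline; case: eqP => [p0|_]; last by rewrite addn1.
    by rewrite p0 mem0v in pW.
  apply/eqP; rewrite -subv0; apply/subvP => v; rewrite memv_cap => /andP[vW /vlineP[k vE]].
  have [k0|k0] := eqVneq k 0; first by rewrite vE k0 scale0r mem0v.
  exfalso; move/negP: pW; apply; rewrite -[_ - _]scale1r -(mulVf k0) -scalerA -vE.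
  exact: memvZ.
have [|||s [sm sY Xs]] := IH W'.
- by apply: subv_trans YW _; exact: addvSl.
- by rewrite subv_add WX -memvE GX.
- by rewrite dX dW' addSnnS.
exists (p :: s); split=> /=; first by rewrite sm.
- move=> q; rewrite inE => /orP[/eqP ->|/sY//].
  by apply: contra pW; exact: (subvP YW).
- by rewrite span_cons addvA.
Qed.

End Necessity.

(** * Assembling both directions of the equivalence *)

Section ExtensionData.
Context {R : realType} {n : nat}.
Implicit Types (E A : set 'rV[R]_n) (X : {vspace 'rV[R]_n}).

Lemma eq_jet_span E (xi xi' : 'rV[R]_n -> 'rV[R]_n) :
  (forall y, E y -> xi y = xi' y) -> jet_span E xi = jet_span E xi'.
Proof.
move=> xiE; rewrite /jet_span; congr setspan; apply/seteqP.
by split=> v [y Ey [z Ez <-]]; exists y => //; exists z => //; rewrite !xiE.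
Qed.

Lemma jet_span_sub E (xi : 'rV[R]_n -> 'rV[R]_n) (W : {vspace 'rV[R]_n}) :
  (forall y z, E y -> E z -> xi y - xi z \in W) -> (jet_span E xi <= W)%VS.
Proof.
move=> h; apply/subvP => v /mem_setspan[s sE]; apply: subvP; apply/span_subvP.
by move=> w /sE[y Ey [z Ez <-]]; exact: h.
Qed.

Lemma C11_convex_extensionS E A (f t : 'rV[R]_n -> R)
    (G xi : 'rV[R]_n -> 'rV[R]_n) X F : E `<=` A ->
  (forall y, E y -> t y = f y /\ xi y = G y) ->
  C11_convex_extension A t xi X F -> C11_convex_extension E f G X F.
Proof.
move=> EA tf [cF F11 Ft Fxi XF]; split=> // y Ey.
  by rewrite Ft ?(tf y Ey).1//; exact: EA.
by rewrite Fxi ?(tf y Ey).2//; exact: EA.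
Qed.

Lemma whitney_of_C11_convex E X (F : 'rV[R]_n -> R) (t : 'rV[R]_n -> R)
    (xi : 'rV[R]_n -> 'rV[R]_n) : convex F -> C11loc dotv F ->
  subdiff_span F = X -> jet_span E xi = X ->
  (forall y, E y -> t y = F y /\ xi y = gradient dotv F y) ->
  exists phi : 'rV[R]_n -> subvs_of X -> R, whitney_condition E t xi phi.
Proof.
move=> cF F11 XF EX tF.
apply: (whitney_of_extension (C11loc_subgradient cF F11)
  (C11loc_subgradient_unique F11) (C11loc_quadratic cF F11) F11.2 _ EX tF).
by rewrite -XF => x y; exact: mem_subdiff_span.
Qed.

Lemma subdiff_span_sub (F : 'rV[R]_n -> R) (W : {vspace 'rV[R]_n}) :
  convex F -> C11loc dotv F ->
  (forall x y, gradient dotv F x - gradient dotv F y \in W) ->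
  (subdiff_span F <= W)%VS.
Proof.
move=> cF F11 h; apply/subvP => v /mem_setspan[s sF]; apply: subvP; apply/span_subvP.
move=> w /sF[x [y [u [u' [/(C11loc_subdifferential cF F11) -> ]]]]].
by move=> /(C11loc_subdifferential cF F11) -> ->.
Qed.

End ExtensionData.

Theorem theorem2p2 (R : realType) (n : nat) (E : set 'rV[R]_n)
    (X : {vspace 'rV[R]_n}) (f : 'rV[R]_n -> R) (G : 'rV[R]_n -> 'rV[R]_n)
    (E_nonempty : E !=set0) :
  let Y := jet_span E G in
  let k := \dim Y in
  let d := \dim X in
  ((exists F : 'rV[R]_n -> R, C11_convex_extension E f G X F) <->
   [/\ (Y <= X)%VS,
       (k < d)%N ->
         exists (p : 'I_(d - k) -> 'rV[R]_n) (beta : 'I_(d - k) -> R)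
                (w : 'I_(d - k) -> 'rV[R]_n)
                (t : 'rV[R]_n -> R) (xi : 'rV[R]_n -> 'rV[R]_n)
                (phi : 'rV[R]_n -> subvs_of X -> R),
           adjoined_jet E f G p beta w t xi /\
           whitney_condition (E `|` range p) t xi phi
     & k = d ->
         exists phi : 'rV[R]_n -> subvs_of X -> R,
           whitney_condition E f G phi]) /\
  ((Y <= X)%VS ->
   ((k < d)%N ->
      forall (p : 'I_(d - k) -> 'rV[R]_n) (beta : 'I_(d - k) -> R)
             (w : 'I_(d - k) -> 'rV[R]_n)
             (t : 'rV[R]_n -> R) (xi : 'rV[R]_n -> 'rV[R]_n)
             (phi : 'rV[R]_n -> subvs_of X -> R),
        adjoined_jet E f G p beta w t xi ->
        whitney_condition (E `|` range p) t xi phi ->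
        forall a : R, 0 < a ->
          C11_convex_extension E f G X
            (extension_formula (E `|` range p) t xi phi a)) /\
   (k = d ->
      forall phi : 'rV[R]_n -> subvs_of X -> R,
        whitney_condition E f G phi ->
        forall a : R, 0 < a ->
          C11_convex_extension E f G X (extension_formula E f G phi a))).
Proof.
move=> Y k d; split; last first.
  move=> YX; split=> [kd p beta w t xi phi [_ tf _] wA a a0|kd phi wE a a0].
    apply: (C11_convex_extensionS (A := E `|` range p) _ tf).
      exact: subsetUl.
    apply: whitney_extension wA a0.
    by have [e Ee] := E_nonempty; exists e; left.
  exact: whitney_extension wE a0.
split=> [[F [cF F11 Ff FG XF]]|[YX kd_ext kd_eq]]; last first.
  (* With [Y] inside [X] the cases [k < d] and [k = d] are exhaustive; in each the formula with
     [a = 1] is an extension. *)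
  have kd : (k <= d)%N by exact: dimvS.
  have [kd'|kd'|kd'] := ltngtP k d; last 1 first.
  - have [phi wE] := kd_eq kd'; exists (extension_formula E f G phi 1).
    exact: whitney_extension wE ltr01.
  - have [p [beta [w [t [xi [phi [[_ tf _] wA]]]]]]] := kd_ext kd'.
    exists (extension_formula (E `|` range p) t xi phi 1).
    apply: (C11_convex_extensionS (A := E `|` range p) _ tf).
      exact: subsetUl.
    apply: whitney_extension wA ltr01.
    by have [e Ee] := E_nonempty; exists e; left.
  - by rewrite ltnNge kd in kd'.
have nablaX x y : gradient dotv F x - gradient dotv F y \in X.
  by rewrite -XF; exact: mem_subdiff_span.
have YE : Y = jet_span E (gradient dotv F).
  by apply: eq_jet_span => y Ey; rewrite FG.
have YX : (Y <= X)%VS by rewrite YE; exact: jet_span_sub.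
split=> // [kd|kd]; last first.
  apply: (whitney_of_C11_convex cF F11 XF).
    by apply/eqP; rewrite eqEdim -/Y YX -/k kd leqnn.
  by move=> y Ey; rewrite Ff ?FG.
have [e Ee] := E_nonempty.
(* Starting from [W = Y], exactly [d - k] gradients complete [Y] to [X]; minimality holds because
   [X] is the span of the differences of gradients of [F]. *)
have [||||s [sm sY Xs]] := @new_points R n X (gradient dotv F) nablaX e Y (d - k) Y.
- by move=> W'; rewrite -XF; exact: subdiff_span_sub.
- exact: subvv.
- exact: YX.
- by rewrite subnK// ltnW.
pose p (j : 'I_(d - k)) := s`_j.
have ps j : p j \in s by rewrite mem_nth// sm.
have pE j : ~ E (p j).
  by move=> Epj; move/negP: (sY _ (ps j)); apply; rewrite YE; exact: jet_span_mem.
have AX : jet_span (E `|` range p) (gradient dotv F) = X.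
  apply/eqP; rewrite eqEsubv jet_span_sub//=.
  apply: subv_trans Xs _; rewrite subv_add; apply/andP; split.
    by rewrite YE; apply: jet_span_sub => y z Ey Ez; apply: jet_span_mem; left.
  apply/span_subvP => _ /mapP[q qs ->]; apply: jet_span_mem; last by left.
  have qi : (index q s < d - k)%N by rewrite -sm index_mem.
  by right; exists (Ordinal qi) => //; rewrite /p /= nth_index.
have [phi wA] := whitney_of_C11_convex cF F11 XF AX
  (fun y _ => conj (erefl (F y)) (erefl (gradient dotv F y))).
(* The enlarged jet is that of [F] itself, at the old and the new points alike. *)
exists p, (F \o p), (gradient dotv F \o p), F, (gradient dotv F), phi.
by split=> //; split=> // y Ey; rewrite Ff ?FG.
Qed.
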